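(* Let $s\ge 1$ and $N\geq 2$ be integers, let $r>0$ be an odd integer, and let $\boldsymbol{z}_1,\ldots,\boldsymbol{z}_r$ be chosen independently and uniformly at random (with replacement) from the set $\mathbb{U}_N^s$, where $\mathbb{U}_N=\{1\le z\le N-1 \mid \gcd(z,N)=1\}$. Then, for any real $\alpha>1/2$ and any set of positive weights $\boldsymbol{\gamma}=\{\gamma_u\}_{u\subseteq\{1,\ldots,s\}}$ with $\gamma_\emptyset=1$, and for any $0<\eta<1$, the worst-case error of the median rule $M_{N,s,r}$ in the weighted Korobov space $\mathcal{F}^{\mathrm{kor}}_{s,\alpha,\boldsymbol{\gamma}}$ satisfies \[ e^{\mathrm{wor}}(M_{N,s,r}; \mathcal{F}^{\mathrm{kor}}_{s,\alpha,\boldsymbol{\gamma}}) \leq \inf_{1/(2\alpha) < \lambda<1}\left(\frac{1}{\eta\,\varphi(N)} \sum_{\emptyset \neq u\subseteq \{1,\ldots,s\}}\gamma_u^{2\lambda}(2\zeta(2\alpha\lambda))^{|u|}\right)^{1/(2\lambda)} \] with probability (over the random choice of $\boldsymbol{z}_1,\ldots,\boldsymbol{z}_r$) at least \[ 1-\binom{r}{(r+1)/2}\eta^{(r+1)/2},\] where $\varphi$ and $\zeta$ denote the Euler totient function and the Riemann zeta function, respectively.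
   Context: For an integrable function $f:[0,1)^s\to\mathbb{R}$ write $I_s(f)=\int_{[0,1)^s}f(\boldsymbol{x})\,d\boldsymbol{x}$, and for a finite point set $P$ of $N$ points (counted with multiplicity) write $Q_P(f)=\frac1N\sum_{\boldsymbol{x}\in P}f(\boldsymbol{x})$. Rank-1 lattice point set: for $\boldsymbol{z}=(z_1,\ldots,z_s)\in\{1,\ldots,N-1\}^s$, \[ P_{N,s,\boldsymbol{z}}=\left\{\left(\left\{\tfrac{nz_1}{N}\right\},\ldots,\left\{\tfrac{nz_s}{N}\right\}\right)\in[0,1)^s \;\middle|\; n=0,1,\ldots,N-1\right\},\] where $\{x\}=x-\lfloor x\rfloor$ is the fractional part of $x$. Weighted Korobov space: for $\alpha>1/2$ and positive weights $\boldsymbol{\gamma}=\{\gamma_u\}_{u\subseteq\{1,\ldots,s\}}$ with $\gamma_\emptyset=1$, for a non-empty $u\subseteq\{1,\ldots,s\}$ and $\boldsymbol{k}_u\in(\mathbb{Z}\setminus\{0\})^{|u|}$, let $(\boldsymbol{k}_u,\boldsymbol{0})\in\mathbb{Z}^s$ be the vector whose $j$-th component is $k_j$ if $j\in u$ and $0$ otherwise. Put $r_{\alpha,\boldsymbol{\gamma}}(\boldsymbol{k}_u,\boldsymbol{0})=\gamma_u\prod_{j\in u}|k_j|^{-\alpha}$ and $r_{\alpha,\boldsymbol{\gamma}}(\boldsymbol{0})=1$. The space $\mathcal{F}^{\mathrm{kor}}_{s,\alpha,\boldsymbol{\gamma}}$ is the reproducing kernel Hilbert space of (real-valued, periodic)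 functions on $[0,1)^s$ with kernel \[K^{\mathrm{kor}}_{s,\alpha,\boldsymbol{\gamma}}(\boldsymbol{x},\boldsymbol{y})=\sum_{\boldsymbol{k}\in\mathbb{Z}^s}(r_{\alpha,\boldsymbol{\gamma}}(\boldsymbol{k}))^2\exp(2\pi i\,\boldsymbol{k}\cdot(\boldsymbol{x}-\boldsymbol{y}))\] and inner product $\langle f,g\rangle^{\mathrm{kor}}_{s,\alpha,\boldsymbol{\gamma}}=\sum_{\boldsymbol{k}\in\mathbb{Z}^s}\hat f(\boldsymbol{k})\overline{\hat g(\boldsymbol{k})}/(r_{\alpha,\boldsymbol{\gamma}}(\boldsymbol{k}))^2$, where $\hat f(\boldsymbol{k})=\int_{[0,1)^s}f(\boldsymbol{x})\exp(-2\pi i\,\boldsymbol{k}\cdot\boldsymbol{x})\,d\boldsymbol{x}$. The induced norm is denoted $\|f\|^{\mathrm{kor}}_{s,\alpha,\boldsymbol{\gamma}}$. Median rule: given $\boldsymbol{z}_1,\ldots,\boldsymbol{z}_r$, \[M_{N,s,r}(f)=\operatorname{median}\left(Q_{P_{N,s,\boldsymbol{z}_1}}(f),\ldots,Q_{P_{N,s,\boldsymbol{z}_r}}(f)\right).\] Its worst-case error is the random variable (a function of $\boldsymbol{z}_1,\ldots,\boldsymbol{z}_r$) \[e^{\mathrm{wor}}(M_{N,s,r};\mathcal{F}^{\mathrm{kor}}_{s,\alpha,\boldsymbol{\gamma}})=\sup_{f\in\mathcal{F}^{\mathrm{kor}}_{s,\alpha,\boldsymbol{\gamma}},\ \|f\|^{\mathrm{kor}}_{s,\alpha,\boldsymbol{\gamma}}\le1}|M_{N,s,r}(f)-I_s(f)|,\]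 i.e. the vectors are drawn first and then the supremum over $f$ is taken. *)

(* Defs.v *)
From HB Require Import structures.
From mathcomp Require Import all_boot all_order all_algebra.
From mathcomp Require Import all_classical all_reals all_analysis.
From mathcomp Require Import complex.
Set Implicit Arguments.
Unset Strict Implicit.
Unset Printing Implicit Defensive.
Import Order.TTheory GRing.Theory Num.Theory.
Import numFieldNormedType.Exports.
Local Open Scope classical_set_scope.
Local Open Scope ring_scope.

Notation Rn R s := (s.-tuple (measurableTypeR R)).

Section lebesgue_tuple.
Context (R : realType).
Implicit Type n : nat.

Definition cons_pair n (p : measurableTypeR R * Rn R n) : Rn R n.+1 :=
  [the n.+1.-tuple _ of p.1 :: p.2].

Lemma measurable_cons_pair n : measurable_fun setT (@cons_pair n).
Proof. exact: measurable_cons. Qed.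

Section step.
Variables (n : nat) (m : {sigma_finite_measure set (Rn R n) -> \bar R}).

Definition lebesgue_cons : set (Rn R n.+1) -> \bar R :=
  pushforward (lebesgue_measure \x m)%E (@cons_pair n).

Let lebesgue_cons0 : lebesgue_cons set0 = 0%E.
Proof. by rewrite /lebesgue_cons /pushforward preimage_set0 measure0. Qed.

Let lebesgue_cons_ge0 A : (0 <= lebesgue_cons A)%E.
Proof. by rewrite /lebesgue_cons /pushforward; exact: (measure_ge0 (_ \x _)%E). Qed.

Let lebesgue_cons_sigma_additive : semi_sigma_additive lebesgue_cons.
Proof.
have mc B : measurable B -> measurable (@cons_pair n @^-1` B).
  by move=> mB; rewrite -[X in measurable X]setTI; exact: measurable_cons_pair.
move=> F mF tF mUF; rewrite /lebesgue_cons /pushforward preimage_bigcup.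
apply: measure_semi_sigma_additive.
- by move=> k; exact: mc.
- apply/trivIsetP => /= i j _ _ ij; rewrite -preimage_setI.
  by move/trivIsetP : tF => /(_ _ _ _ _ ij) ->//; rewrite preimage_set0.
- by rewrite -preimage_bigcup; exact: mc.
Qed.

HB.instance Definition _ := isMeasure.Build _ _ _ lebesgue_cons
  lebesgue_cons0 lebesgue_cons_ge0 lebesgue_cons_sigma_additive.

Let uncons (t : Rn R n.+1) : measurableTypeR R * Rn R n :=
  (thead t, [tuple of behead t]).

Let measurable_uncons : measurable_fun setT uncons.
Proof.
apply/measurable_fun_pairP; split.
  exact: measurable_tnth.
exact: measurable_behead.
Qed.

Let cons_pairK : cancel (@cons_pair n) uncons.
Proof. by move=> [x t]; congr pair => //; exact: val_inj. Qed.

Let lebesgue_cons_sigma_finite : sigma_finite setT lebesgue_cons.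
Proof.
pose mu : {sigma_finite_measure set (measurableTypeR R) -> \bar R} :=
  lebesgue_measure.
have /sigma_finiteP[F [TF ndF Foo]] := sigma_finiteT mu.
have /sigma_finiteP[G [TG ndG Goo]] := sigma_finiteT m.
exists (fun k => uncons @^-1` (F k `*` G k)).
  apply/esym; rewrite -subTset => t _.
  have [i _ Fi] : (\bigcup_i F i) (uncons t).1 by rewrite -TF.
  have [j _ Gj] : (\bigcup_j G j) (uncons t).2 by rewrite -TG.
  exists (maxn i j) => //; split.
    by move: Fi; exact/subsetPset/ndF/leq_maxl.
  by move: Gj; exact/subsetPset/ndG/leq_maxr.
move=> k; have [mF Fk] := Foo k; have [mG Gk] := Goo k; split.
  by rewrite -[X in measurable X]setTI; apply: measurable_uncons => //;
    exact: measurableX.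
rewrite /lebesgue_cons /pushforward -comp_preimage.
rewrite (_ : uncons \o _ = id) ?preimage_id//.
  by rewrite product_measure1E// lte_mul_pinfty// ge0_fin_numE.
by apply/funext => p; exact: cons_pairK.
Qed.

HB.instance Definition _ := Measure_isSigmaFinite.Build _ _ _ lebesgue_cons
  lebesgue_cons_sigma_finite.
End step.

(* Lebesgue measure on R^s, built by recursion on s with binary products. *)
Fixpoint lebesgue_tuple (s : nat) : {sigma_finite_measure set (Rn R s) -> \bar R} :=
  match s with
  | 0 => \d_([tuple] : Rn R 0)
  | n.+1 => lebesgue_cons (lebesgue_tuple n)
  end.

Lemma lebesgue_tuple_box s (A : 'I_s -> set (measurableTypeR R)) :
  (forall j, measurable (A j)) ->
  lebesgue_tuple s [set x | forall j, A j (tnth x j)] =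
  (\prod_(j < s) lebesgue_measure (A j))%E.
Proof.
elim: s A => [|n IH] A mA; first by rewrite big_ord0 /= diracE mem_set// => -[].
rewrite big_ord_recl -IH//= /lebesgue_cons /pushforward -product_measure1E//.
  congr (_ _); apply/seteqP; split => [[x t] /= Axt|[x t] /= [A0 At] j].
    split; first exact: (Axt ord0).
    by move=> j; have := Axt (lift ord0 j); rewrite tnthS.
  by case: (unliftP ord0 j) => [k ->|->//]; rewrite tnthS.
rewrite (_ : mkset _ = \bigcap_(j in [set: 'I_n])
    (fun x : Rn R n => tnth x j) @^-1` A (lift ord0 j)); last first.
  by apply/seteqP; split => [x Ax j _|x Ax j]; [exact: Ax|exact: (Ax j)].
apply: fin_bigcap_measurable => // j _.
by rewrite -[X in measurable X]setTI; exact: measurable_tnth.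
Qed.

End lebesgue_tuple.
Arguments lebesgue_tuple : clear implicits.

Section definitions.
Local Open Scope complex_scope.
Context (R : realType).

Definition unit_cube s : set (Rn R s) :=
  [set x | forall j, 0 <= tnth x j < 1].
Arguments unit_cube : clear implicits.

Definition Iint s (f : Rn R s -> R) : R :=
  \int[lebesgue_tuple R s]_(x in unit_cube s) f x.

Definition Qrule s (P : seq (Rn R s)) (f : Rn R s -> R) : R :=
  (size P)%:R^-1 * \sum_(x <- P) f x.

Definition frac_part (x : R) : R := x - (Num.floor x)%:~R.

Definition lattice_point N s (z : s.-tuple 'I_N) (n : nat) : Rn R s :=
  [tuple frac_part ((n * tnth z j)%:R / N%:R) | j < s].

Definition lattice N s (z : s.-tuple 'I_N) : seq (Rn R s) :=
  [seq lattice_point z n | n <- iota 0 N].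

(* The median of an odd number of values; only used in that case. *)
Definition median (v : seq R) : R := nth 0 (sort <=%R v) (size v)./2.

Definition median_rule N s r (z : 'I_r -> s.-tuple 'I_N) (f : Rn R s -> R) : R :=
  median [seq Qrule (lattice (z i)) f | i <- enum 'I_r].

Definition expi (t : R) : R[i] := cos t +i* sin t.

Definition dotZ s (k : s.-tuple int) (x : Rn R s) : R :=
  \sum_(j < s) (tnth k j)%:~R * tnth x j.

Definition wave s (k : s.-tuple int) (x : Rn R s) : R[i] :=
  expi (2 * pi * dotZ k x).

Definition cintegral s (g : Rn R s -> R[i]) : R[i] :=
  Iint (fun x => complex.Re (g x)) +i* Iint (fun x => complex.Im (g x)).

Definition fourier s (f : Rn R s -> R[i]) (k : s.-tuple int) : R[i] :=
  cintegral (fun x => f x * (wave k x)^*).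

(* Sums over Z^s are unconditional: positive and negative parts are summed
   separately with [esum], which gives the sum of an absolutely convergent
   family. *)
Definition rsum (T : choiceType) (a : T -> R) : R :=
  fine (\esum_(k in [set: T]) (Num.max (a k) 0)%:E) -
  fine (\esum_(k in [set: T]) (Num.max (- a k) 0)%:E).

Definition csum (T : choiceType) (a : T -> R[i]) : R[i] :=
  rsum (fun k => complex.Re (a k)) +i* rsum (fun k => complex.Im (a k)).

Definition csummable (T : choiceType) (a : T -> R[i]) : Prop :=
  summable setT (fun k => (complex.Re (a k))%:E) /\
  summable setT (fun k => (complex.Im (a k))%:E).

Section korobov.
Variables (s : nat) (alpha : R) (gamma : {set 'I_s} -> R).
Implicit Types (k : s.-tuple int) (x y : Rn R s).

Definition zsupport k : {set 'I_s} := [set j | tnth k j != 0].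

Definition korobov_r k : R :=
  gamma (zsupport k) *
  \prod_(j in zsupport k) (`|tnth k j|%:~R `^ (- alpha)).

Definition korobov_kernel x y : R[i] :=
  csum (fun k => ((korobov_r k) ^+ 2)%:C *
                 wave k [tuple tnth x j - tnth y j | j < s]).

Definition korobov_term (f g : Rn R s -> R[i]) k : R[i] :=
  fourier f k * (fourier g k)^* / ((korobov_r k) ^+ 2)%:C.

Definition korobov_ip (f g : Rn R s -> R[i]) : R[i] := csum (korobov_term f g).

Definition to_complex (f : Rn R s -> R) (x : Rn R s) : R[i] := (f x)%:C.

Definition korobov_norm (f : Rn R s -> R) : R :=
  Num.sqrt (complex.Re (korobov_ip (to_complex f) (to_complex f))).

(* The reproducing kernel Hilbert space with kernel [korobov_kernel] and inner
   product [korobov_ip]: the integrable real functions of finite norm that the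
   kernel reproduces at every point of the cube.  The reproducing property
   selects, in each class of almost everywhere equal functions, the member of
   the space; it also excludes functions with no such representative.  Values
   outside [0,1)^s are irrelevant (one may think of the periodic extension). *)
Definition korobov_space : set (Rn R s -> R) :=
  [set f : Rn R s -> R | [/\ (lebesgue_tuple R s).-integrable (unit_cube s) (EFin \o f),
               csummable (korobov_term (to_complex f) (to_complex f)) &
               forall y, unit_cube s y ->
                 (f y)%:C = korobov_ip (to_complex f) (korobov_kernel ^~ y)]].

(* An extended real, so that the supremum is meaningful without a boundedness
   proof. *)
Definition worst_case_error (A : (Rn R s -> R) -> R) : \bar R :=
  ereal_sup [set `|A f - Iint f|%:E |
             f in [set f : Rn R s -> R | korobov_space f /\ korobov_norm f <= 1]].

End korobov.

Definition zeta (x : R) : R :=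
  limn (series (fun n : nat => (n.+1)%:R `^ (- x))).

Definition error_term N s (alpha : R) (gamma : {set 'I_s} -> R) (eta lambda : R) : R :=
  ((eta * (totient N)%:R)^-1 *
   \sum_(u : {set 'I_s} | u != finset.set0)
     gamma u `^ (2 * lambda) * (2 * zeta (2 * alpha * lambda)) ^+ #|u|)
  `^ (2 * lambda)^-1.

Definition error_bound N s (alpha : R) (gamma : {set 'I_s} -> R) (eta : R) : \bar R :=
  ereal_inf [set (error_term N alpha gamma eta lambda)%:E |
             lambda in [set lambda | (2 * alpha)^-1 < lambda < 1]].

End definitions.

Definition unit_residues N : {set 'I_N} :=
  [set z : 'I_N | (1 <= z)%N && coprime z N].

Definition unit_vectors N s : {set s.-tuple 'I_N} :=
  [set z : s.-tuple 'I_N | [forall j, tnth z j \in unit_residues N]].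

Section random.
Context (R : realType) (d : measure_display) (Omega : measurableType d).
Variable P : probability Omega R.

(* A random variable with values in a finite type, uniform on [A]. *)
Definition uniform_on (F : finType) (A : {set F}) (X : Omega -> F) : Prop :=
  forall v, measurable (X @^-1` [set v]) /\
    P (X @^-1` [set v]) = ((v \in A)%:R / #|A|%:R)%:E.

Definition mutually_independent (I F : finType) (X : I -> Omega -> F) : Prop :=
  forall (J : {set I}) (B : I -> set F),
    P [set w | forall i, i \in J -> B i (X i w)] =
    (\prod_(i in J) P (X i @^-1` B i))%E.

End random.

(* Main.v *)
Require Import Defs.
From mathcomp Require Import all_boot all_order all_algebra.
From mathcomp Require Import all_classical all_reals all_analysis.
From mathcomp Require Import measurable_realfun complex ring lra zify.
Set Implicit Arguments.
Unset Strict Implicit.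
Unset Printing Implicit Defensive.
Import Order.TTheory GRing.Theory Num.Theory.
Import numFieldNormedType.Exports.
Local Open Scope classical_set_scope.
Local Open Scope ring_scope.

(** The idea is Fourier analysis on the dual lattice, followed by a union bound
    over the [r] draws.

    A function [f] of the space is the sum of its Fourier series at every point
    of the cube: the reproducing property expresses [f y] through the Fourier
    coefficients of the kernel section at [y], and these are
    [rho(k)^2 * conj (wave k y)], where [rho] is [korobov_r alpha gamma]
    ([fourier_kernel], obtained by exchanging sum and integral,
    [Rintegral_rsum]).  Averaging [wave k] over the lattice of a
    generating vector [z] gives 1 if [N] divides the scalar product [k.z] and 0
    otherwise ([sum_wave_lattice]), so the error of one lattice rule is the sum
    of the coefficients [fhat k] over the nonzero [k] of the dual lattice.  For
    [f] in the unit ball it is therefore at most [B] as soon as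
    [S z := sum of rho(k)^2] over these [k] is at most [B ^ 2]
    ([Qrule_error]).  This criterion depends on [z] alone; hence when it holds
    for more than half of the vectors drawn, all functions of the unit ball have
    a median within [B] of the integral simultaneously
    ([worst_case_error_median]).

    It remains to see that [S z] exceeds [error_term lambda ^ 2] for at most a
    proportion [eta] of the admissible vectors.  Since [S z] is at most
    [(sum of rho(k)^(2 lambda))^(1/lambda)] ([rsum_le_powR]), Markov's inequality
    reduces this to the mean over [z] of [sum of rho(k)^(2 lambda)] on the dual
    lattice.  In one coordinate, the congruence [k * z = - c] modulo [N] forces
    [d := gcd(c, N)] to divide [k] and then has at most [d] solutions [z]
    ([card_unit_solutions]); the factor [d] is absorbed by
    [|d k'|^-a <= d^-1 |k'|^-a], so the sum over units [z] and nonzero [k]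
    stays below [2 zeta(a)] for each [c] ([sum_unit_abs_powN]).  In [s]
    coordinates one coordinate of the support of [k] is used in this way, with
    the others frozen, and saves one factor [totient N]
    ([sum_esum_congr_weight]).

    The infimum over [lambda] costs nothing: there are finitely many vectors, so
    the exponent that condemns the bad vector with the smallest [S] condemns all
    of them ([card_bad_vector]).  Finally the median can only fail if some
    [(r + 1) / 2] draws are all bad, an event of probability at most
    [eta ^ ((r + 1) / 2)] by independence for each of the ['C(r, (r + 1) / 2)]
    choices of these draws ([probability_majority]). *)

(** * Unconditional sums over countable types *)

Section countable_sums.
Context (R : realType) (T : countType).
Implicit Types a b c : T -> R.

(** The terms of the series obtained by enumerating [T]; codes that denote no
    element of [T] contribute 0. *)
Definition enum_term a (n : nat) : R := oapp a 0 (@pickle_inv T n).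

Definition rsummable a := summable [set: T] (EFin \o a).

(** Reduces a sum over [T] to a series over [nat], for which linearity and limit
    theorems are at hand. *)
Lemma esum_countable (f : T -> \bar R) : (forall k, 0 <= f k)%E ->
  (\esum_(k in [set: T]) f k = \sum_(n <oo) oapp f 0 (@pickle_inv T n))%E.
Proof.
move=> f0; pose b n : \bar R := oapp f 0%E (@pickle_inv T n).
have b0 n : (0 <= b n)%E by rewrite /b; case: pickle_inv => //=.
rewrite (nneseries_esumT b0).
(* Indices outside the range of [pickle] carry the value 0. *)
rewrite (_ : esum _ b = (\esum_(n in range (@pickle T)) b n)%E); last first.
  rewrite [RHS]esum_mkcond; apply: eq_esum => n _; case: ifPn => // nr.
  rewrite /b; case E: (@pickle_inv T n) => [t|//]; case/negP: nr.
  have := @pickle_invK T n; rewrite E /= => <-.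
  by rewrite inE; exists t.
rewrite esum_image; last by move=> x y _ _ /(pcan_inj (@pickleK T)).
by apply: eq_esum => k _; rewrite /b pickleK_inv.
Qed.

Lemma rsummable_le a b : (forall k, `|a k| <= b k) -> rsummable b ->
  rsummable a.
Proof.
move=> ab; apply: le_lt_trans; apply: le_esum => k _ /=.
by rewrite lee_fin (le_trans (ab k))// ler_norm.
Qed.

Lemma rsummableD a b : rsummable a -> rsummable b ->
  rsummable (fun k => a k + b k).
Proof. exact: summableD. Qed.

Lemma esumZl (f : T -> \bar R) (x : R) : (0 <= x)%R -> (forall k, 0 <= f k)%E ->
  (\esum_(k in [set: T]) (x%:E * f k) = x%:E * \esum_(k in [set: T]) f k)%E.
Proof.
move=> x0 f0; rewrite !esum_countable//; last by move=> k; apply: mule_ge0.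
rewrite -nneseriesZl//; last by move=> n _; case: pickle_inv => /=.
by apply: eq_eseriesr => n _; case: pickle_inv => //=; rewrite mule0.
Qed.

Lemma rsummableZ (x : R) a : rsummable a -> rsummable (fun k => x * a k).
Proof.
rewrite /rsummable /summable => sa.
rewrite (eq_esum (b := fun k => (`|x|%:E * `|(EFin \o a) k|)%E)); last first.
  by move=> k _ /=; rewrite -EFinM normrM.
by rewrite esumZl// lte_mul_pinfty.
Qed.

Lemma ge0_esum_cvg a : (forall k, 0 <= a k) -> rsummable a ->
  series (enum_term a) @ \oo --> fine (\esum_(k in [set: T]) (a k)%:E)%E.
Proof.
move=> a0 sa.
have ea0 n : 0 <= enum_term a n by rewrite /enum_term; case: pickle_inv => /=.
have eqa : (\esum_(k in [set: T]) (a k)%:E = \sum_(n <oo) (enum_term a n)%:E)%E.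
  rewrite esum_countable; last by move=> k; rewrite lee_fin.
  by apply: eq_eseriesr => n _; rewrite /enum_term; case: pickle_inv.
have fina : (\sum_(n <oo) (enum_term a n)%:E < +oo)%E.
  rewrite -eqa; apply: le_lt_trans sa; apply: le_esum => k _.
  by rewrite /= lee_fin ler_norm.
have := nnseries_is_cvg ea0 fina.
move=> c; rewrite eqa.
suff -> : (\sum_(n <oo) (enum_term a n)%:E = (limn (series (enum_term a)))%:E)%E by [].
rewrite -EFin_lim//; apply/congr_lim/funext => n /=.
by rewrite sumEFin.
Qed.

(** The bridge from [rsum] to ordinary convergence: positive and negative parts
    converge separately, so the enumerated series converges to their difference.
    Linearity and monotonicity of [rsum] are read off the limit. *)
Lemma cvg_rsum a : rsummable a -> series (enum_term a) @ \oo --> rsum a.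
Proof.
move=> sa.
have sm (b : T -> R) : (forall k, `|b k| <= `|a k|) -> rsummable b.
  move=> ba; apply: le_lt_trans sa; apply: le_esum => k _.
  by rewrite /= lee_fin.
pose p k := Num.max (a k) 0; pose q k := Num.max (- a k) 0.
have -> : series (enum_term a) = series (enum_term p) - series (enum_term q).
  rewrite -seriesN -seriesD; congr series; apply/funext => n.
  rewrite !fctE /enum_term /p /q; case: pickle_inv => //= [k|]; last by rewrite subr0.
  by case: (leP (a k)) => ?; case: (leP (- a k)) => ?; lra.
apply: cvgB; apply: ge0_esum_cvg.
- by move=> k; rewrite le_max lexx orbT.
- apply: sm => k; rewrite /p; case: (leP (a k)) => ?; first by rewrite normr0.
  by [].
- by move=> k; rewrite le_max lexx orbT.
- apply: sm => k; rewrite /q; case: (leP (- a k)) => ?; first by rewrite normr0.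
  by rewrite normrN.
Qed.

Lemma rsumE a : rsummable a -> rsum a = limn (series (enum_term a)).
Proof. by move=> /cvg_rsum /cvg_lim ->. Qed.

Lemma rsumD a b : rsummable a -> rsummable b ->
  rsum (fun k => a k + b k) = rsum a + rsum b.
Proof.
move=> sa sb; rewrite rsumE; last exact: rsummableD.
apply/cvg_lim => //.
rewrite (_ : series _ = series (enum_term a) + series (enum_term b)).
  by apply: cvgD; apply: cvg_rsum.
rewrite -seriesD; congr series; apply/funext => n.
by rewrite !fctE /enum_term; case: pickle_inv => //=; rewrite addr0.
Qed.

Lemma rsumZ (x : R) a : rsummable a -> rsum (fun k => x * a k) = x * rsum a.
Proof.
move=> sa; rewrite rsumE; last exact: rsummableZ.
apply/cvg_lim => //.
rewrite (_ : series _ = x *: series (enum_term a)).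
  by apply: cvgZr; exact: cvg_rsum.
rewrite -seriesZ; congr series; apply/funext => n.
by rewrite !fctE /enum_term; case: pickle_inv => //=; rewrite scaler0.
Qed.

Lemma ler_rsum a b : rsummable a -> rsummable b -> (forall k, a k <= b k) ->
  rsum a <= rsum b.
Proof.
move=> sa sb ab; rewrite !rsumE//; apply: lim_series_le.
- by apply/cvg_ex; exists (rsum a); exact: cvg_rsum.
- by apply/cvg_ex; exists (rsum b); exact: cvg_rsum.
- by move=> n; rewrite /enum_term; case: pickle_inv => /=.
Qed.

Lemma rsummable0 : rsummable (fun _ : T => 0).
Proof. by rewrite /rsummable /summable esum1 ?ltry//= => k _; rewrite normr0. Qed.

Lemma rsum_sum (I : Type) (s : seq I) (a : I -> T -> R) :
  (forall i, rsummable (a i)) ->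
  rsummable (fun k => \sum_(i <- s) a i k) /\
  rsum (fun k => \sum_(i <- s) a i k) = \sum_(i <- s) rsum (a i).
Proof.
move=> sa; elim: s => [|i s [IH1 IH2]].
  under [fun k => _]eq_fun do rewrite big_nil.
  split; first exact: rsummable0.
  rewrite big_nil rsumE; last exact: rsummable0.
  apply/cvg_lim => //; rewrite (_ : series _ = cst 0); first exact: cvg_cst.
  apply/funext => n; rewrite /series /= big1// => j _.
  by rewrite /enum_term; case: pickle_inv.
rewrite big_cons -IH2.
under [fun k => _]eq_fun do rewrite big_cons.
split; first exact: rsummableD.
exact: rsumD.
Qed.

Lemma ge0_rsumE a : (forall k, 0 <= a k) -> rsummable a ->
  (rsum a)%:E = (\esum_(k in [set: T]) (a k)%:E)%E.
Proof.
move=> a0 sa; rewrite rsumE// (cvg_lim _ (ge0_esum_cvg a0 sa))// fineK//.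
rewrite ge0_fin_numE ?esum_ge0// => [|k _]; last by rewrite lee_fin.
apply: le_lt_trans sa; apply: le_esum => k _.
by rewrite /= lee_fin ler_norm.
Qed.

Lemma ge0_rsummable a : (forall k, 0 <= a k) ->
  (\esum_(k in [set: T]) (a k)%:E < +oo)%E -> rsummable a.
Proof.
move=> a0; apply: le_lt_trans; apply: le_esum => k _.
by rewrite /= lee_fin ger0_norm.
Qed.

Lemma rsum_single (a : T -> R) k0 : (forall k, k != k0 -> a k = 0) ->
  rsum a = a k0.
Proof.
move=> ak; rewrite /rsum.
have H (b : T -> R) : (forall k, 0 <= b k) -> (forall k, k != k0 -> b k = 0) ->
    fine (\esum_(k in [set: T]) (b k)%:E) = b k0.
  move=> b0 bk; rewrite (esumID [set k0]); last by move=> k _; rewrite lee_fin.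
  rewrite setTI esum_set1 ?lee_fin// esum1 ?adde0// => k [_ /= /eqP kk0].
  by rewrite bk.
rewrite !H; [by case: (leP (a k0)) => ?; case: (leP (- a k0)) => ?; lra| | | |].
- by move=> k; rewrite le_max lexx orbT.
- by move=> k /ak ->; rewrite oppr0 maxxx.
- by move=> k; rewrite le_max lexx orbT.
- by move=> k /ak ->; rewrite maxxx.
Qed.

End countable_sums.

(** * Exchange of sum and integral *)

Section integral_of_sums.
Context d (X : measurableType d) (R : realType).
Variables (mu : {measure set X -> \bar R}) (D : set X).
Hypotheses (mD : measurable D) (muD : (mu D < +oo)%E).

Lemma bounded_integrable (f : X -> R) (M : R) : measurable_fun D f ->
  (forall x, D x -> `|f x| <= M) -> mu.-integrable D (EFin \o f).
Proof.
move=> mf fM; apply: measurable_bounded_integrable => //.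
exists M; split; first exact: num_real.
by move=> y My x Dx; apply: (le_trans (fM x Dx)); exact: ltW.
Qed.

(** Dominated convergence along the enumeration of [T]: the partial sums are
    bounded by the constant [rsum c], which is integrable since [D] has finite
    measure. *)
Lemma Rintegral_rsum (T : countType) (g : T -> X -> R) (c : T -> R) :
  (forall k, measurable_fun D (g k)) ->
  (forall k x, D x -> `|g k x| <= c k) -> (forall k, 0 <= c k) ->
  rsummable c ->
  \int[mu]_(x in D) rsum (fun k => g k x) =
  rsum (fun k => \int[mu]_(x in D) g k x).
Proof.
move=> mg gc c0 sc.
have ig k : mu.-integrable D (EFin \o g k) by exact: bounded_integrable (gc k).
have sg x : D x -> rsummable (fun k => g k x).
  by move=> Dx; apply: rsummable_le sc => k; exact: gc.
have sI : rsummable (fun k => \int[mu]_(x in D) g k x).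
  apply: (@rsummable_le _ _ _ (fun k => fine (mu D) * c k)); last exact: rsummableZ.
  move=> k; apply: (le_trans (le_normr_Rintegral mD (ig k))).
  rewrite mulrC -(Rintegral_cst mu mD); apply: le_Rintegral => //.
  - exact: integrable_norm (ig k).
  - by apply: (bounded_integrable (M := c k)) => // x _; rewrite ger0_norm.
  - by move=> x; exact: gc.
pose e n x := enum_term (fun k => g k x) n.
have ie n : mu.-integrable D (EFin \o e n).
  rewrite /e /enum_term; case: pickle_inv => [k|]; first exact: ig.
  by apply: (bounded_integrable (M := 0)) => // x _; rewrite normr0.
rewrite (rsumE sI); apply/esym/cvg_lim => //.
(* The partial sums of the integrals are the integrals of the partial sums. *)
have -> : series (enum_term (fun k => \int[mu]_(x in D) g k x)) =
   (fun n => \int[mu]_(x in D) series (e^~ x) n).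
  apply/funext => n; elim: n => [|n IHn].
    rewrite /series /= big_geq//; under eq_Rintegral do rewrite big_geq//.
    by rewrite Rintegral_cst// mul0r.
  rewrite seriesSr IHn; under [RHS]eq_Rintegral do rewrite seriesSr.
  rewrite RintegralD//; last first.
    have -> : (EFin \o (fun x => series (e ^~ x) n)) =
       (fun x => \sum_(0 <= i < n) (EFin \o e i) x)%E.
      by apply/funext => x; rewrite /= /series /= sumEFin.
    exact: integrable_sum.
  congr (_ + _); rewrite /e /enum_term; case: pickle_inv => [k|] //=.
  by rewrite Rintegral_cst// mul0r.
pose F n x := (series (e ^~ x) n)%:E.
have mF n : measurable_fun D (F n).
  apply/measurable_EFinP; rewrite /series /=.
  by apply: measurable_sum => i; exact/measurable_EFinP/measurable_int/(ie i).
have cF x : D x -> F ^~ x @ \oo --> (rsum (fun k => g k x))%:E.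
  by move=> Dx; apply: cvg_EFin; [exact: nearW|exact: cvg_rsum (sg x Dx)].
have Fc n x : D x -> (`|F n x| <= (rsum c)%:E)%E.
  move=> Dx; rewrite lee_fin /series /=.
  rewrite (le_trans (ler_norm_sum _ _ _))//.
  rewrite rsumE//; apply: (@le_trans _ _ (series (enum_term c) n)).
    apply: ler_sum => i _; rewrite /e /enum_term; case: pickle_inv => //= [k|].
      exact: gc.
    by rewrite normr0.
  apply: nondecreasing_cvgn_le; last by apply/cvg_ex; exists (rsum c); exact: cvg_rsum.
  apply: nondecreasing_series => i _ _.
  by rewrite /enum_term; case: pickle_inv => /=.
have [iF _ cIF] : [/\ mu.-integrable D (fun x => (rsum (fun k => g k x))%:E),
    [sequence (\int[mu]_(x in D) (`|F n x - (rsum (fun k => g k x))%:E|))%E]_n @ \oo --> 0%E &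
    [sequence (\int[mu]_(x in D) (F n x))%E]_n @ \oo -->
      (\int[mu]_(x in D) (rsum (fun k => g k x))%:E)%E].
  apply: (@dominated_convergence _ _ _ mu D mD F _ (cst (rsum c)%:E)) => //.
  - exact: (emeasurable_fun_cvg _ _ mF cF).
  - exact: aeW.
  - by apply: (@bounded_integrable (cst (rsum c)) `|rsum c|).
  - by apply: aeW => x n; exact: Fc.
by apply: fine_cvg; rewrite fineK//; exact: integrable_fin_num.
Qed.
End integral_of_sums.

(** * Integrals of trigonometric functions over the unit cube *)

Section cube_integrals.
Context (R : realType).
Local Notation leb := (@lebesgue_measure R).

Lemma measurable_unit_cube s : measurable (@unit_cube R s).
Proof.
rewrite (_ : @unit_cube R s = \bigcap_(j in [set: 'I_s])
    (fun x : Rn R s => tnth x j) @^-1` `[0, 1[%classic); last first.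
  by apply/seteqP; split => [x Ax j _|x Ax j]; [|have := Ax j I];
    rewrite /= in_itv/=; [exact: Ax|].
apply: fin_bigcap_measurable => // j _.
rewrite -[X in measurable X]setTI; exact: measurable_tnth.
Qed.

Lemma lebesgue_unit_cube s : lebesgue_tuple R s (@unit_cube R s) = 1%E.
Proof.
rewrite (_ : @unit_cube R s = [set x | forall j, `[0, 1[%classic (tnth x j)]).
  rewrite (@lebesgue_tuple_box R s (fun=> `[0, 1[%classic))//= big1// => j _.
  by rewrite lebesgue_measure_itv/= lte_fin ltr01 oppr0 adde0.
by apply/seteqP; split => x Ax j; have := Ax j; rewrite /= in_itv.
Qed.

Lemma measurable_dotZ s (m : s.-tuple int) :
  measurable_fun setT (fun x : Rn R s => dotZ m x).
Proof.
apply: measurable_sum => j; apply: measurable_funM => //.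
exact: measurable_tnth.
Qed.

Lemma measurable_cos_dotZ s (m : s.-tuple int) (c : R) :
  measurable_fun setT (fun x : Rn R s => cos (2 * pi * dotZ m x + c)).
Proof.
apply: (@measurableT_comp _ _ _ _ _ _ (@cos R)).
  by apply: continuous_measurable_fun; exact: continuous_cos.
apply: measurable_funD => //; apply: measurable_funM => //.
exact: measurable_dotZ.
Qed.

Lemma periodic_cos_int (x : R) (n : int) : cos (x + 2 * pi * n%:~R) = cos x.
Proof.
have H (y : R) (k : nat) : cos (y + 2 * pi * k%:R) = cos y.
  by rewrite -[RHS](periodicn (@cosD2pi R) k) -(mulr_natr (pi *+ 2)) -(mulr_natl pi).
case: n => k; first exact: H.
rewrite NegzE -[LHS](H _ k.+1); congr cos; rewrite mulrNz -pmulrn; ring.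
Qed.

Lemma periodic_sin_int (x : R) (n : int) : sin (x + 2 * pi * n%:~R) = sin x.
Proof. by rewrite -!cosBpihalf -[RHS](periodic_cos_int (x - pi / 2) n) addrAC. Qed.

(** Over a full period the cosine of a nonzero frequency integrates to 0.  The
    free phase [c] covers the sine as well and lets the product formula for the
    cube go through by induction. *)
Lemma integral_cos_itv (m : int) (c : R) :
  (\int[leb]_(x in `[0%R, 1%R[) (cos (2 * pi * (m%:~R * x) + c))%:E =
   if m == 0%R then (cos c)%:E else 0)%E.
Proof.
have [->|m0] := eqVneq m 0.
  under eq_integral do rewrite mul0r mulr0 add0r.
  by rewrite integral_cst//= lebesgue_measure_itv/= lte_fin ltr01 oppr0 adde0 mule1.
have a0 : 2 * pi * m%:~R != 0 :> R.
  by rewrite !mulf_neq0// ?intr_eq0// gt_eqF// pi_gt0.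
set a := 2 * pi * m%:~R in a0 *.
have eqf : (fun x => cos (2 * pi * (m%:~R * x) + c)) = (fun x => cos (a * x + c)).
  by apply/funext => x; rewrite /a mulrA.
have dF (x : R) : is_derive x 1 (fun x => a^-1 * sin (a * x + c)) (cos (a * x + c)).
  rewrite (_ : (fun x => _) = a^-1 \*: (sin \o (a \*: (id : R -> R^o) + cst c))); last first.
    by apply/funext => y /=; rewrite !fctE.
  apply: is_derive_eq; rewrite /=.
  by rewrite !fctE addr0 /GRing.scale /= mulr1 mulrCA mulVf ?mulr1.
have cG (g : R -> R) : continuous g -> continuous (fun x => g (a * x + c)).
  move=> cg x; apply: continuous_comp; last exact: cg.
  by apply: cvgD; [apply: cvgMr; exact: cvg_id|exact: cvg_cst].
rewrite integral_itv_bndo_bndc; last first.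
  apply/measurable_EFinP/measurable_funTS; rewrite eqf.
  by apply: continuous_measurable_fun; apply: cG; exact: continuous_cos.
under eq_integral do rewrite mulrA -/a.
have cFF : continuous (fun x : R => a^-1 * sin (a * x + c)).
  by move=> x; apply: cvgMr; apply: (cG sin); exact: continuous_sin.
rewrite (@continuous_FTC2 _ _ (fun x => a^-1 * sin (a * x + c)))//.
- rewrite mulr1 mulr0 add0r (addrC a c) periodic_sin_int.
  by rewrite -EFinB subrr.
- apply: continuous_subspaceT; apply: cG; exact: continuous_cos.
- split => [x _||].
  + by have [] := dF x.
  + by apply: cvg_at_right_filter; exact: cFF.
  + by apply: cvg_at_left_filter; exact: cFF.
- by move=> x _; rewrite derive1E; have [_ ->] := dF x.
Qed.


Lemma dotZ_cons n (m : n.+1.-tuple int) (p : measurableTypeR R * Rn R n) :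
  dotZ m (cons_pair p) =
  (thead m)%:~R * p.1 + dotZ [tuple of behead m] p.2.
Proof.
rewrite /dotZ big_ord_recl; congr (_ + _).
by apply: eq_bigr => j _; rewrite tnthS [in LHS](tuple_eta m) tnthS.
Qed.

(** The recursive definition of the Lebesgue measure on tuples is by push-forward
    along [cons_pair]; the cube splits accordingly. *)
Lemma cube_cons n : @cons_pair R n @^-1` (@unit_cube R n.+1) =
  `[0, 1[%classic `*` @unit_cube R n.
Proof.
apply/seteqP; split => [[x t] /= Axt|[x t] /= [A0 At] j].
  split; first by have := Axt ord0; rewrite in_itv.
  by move=> j; have := Axt (lift ord0 j); rewrite tnthS.
case: (unliftP ord0 j) => [k ->|->]; first by rewrite tnthS.
by move: A0; rewrite in_itv.
Qed.

(** Orthogonality of the exponentials on the cube, with an arbitrary phase.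
    Integrating out the first coordinate by Fubini leaves the same integral in
    one variable less, the phase absorbing the other coordinates. *)
Lemma integral_cos_cube s (m : s.-tuple int) (c : R) :
  (\int[lebesgue_tuple R s]_(x in @unit_cube R s) (cos (2 * pi * dotZ m x + c))%:E =
   if [forall j, tnth m j == 0%R] then (cos c)%:E else 0)%E.
Proof.
elim: s m c => [|n IHn] m c.
  have mf : measurable_fun (@unit_cube R 0)
      (fun x => (cos (2 * pi * dotZ m x + c))%:E).
    by apply/measurable_EFinP; apply: measurable_funTS; exact: (measurable_cos_dotZ m c).
  rewrite /= integral_dirac//; last exact: measurable_unit_cube.
  rewrite diracE mem_set ?mul1e /dotZ; last by case.
  by rewrite big_ord0 mulr0 add0r ifT//; apply/forallP => -[].
set f := fun x => (cos (2 * pi * dotZ m x + c))%:E.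
have mf : measurable_fun setT f by apply/measurable_EFinP; exact: (measurable_cos_dotZ m c).
pose leb2 := (leb \x lebesgue_tuple R n)%E.
pose I01 : set (measurableTypeR R) := `[0, 1[%classic.
pose D := I01 `*` @unit_cube R n.
have mD : measurable D.
  by apply: measurableX; [exact: measurable_itv|exact: measurable_unit_cube].
have mI : measurable I01 by exact: measurable_itv.
have mC := @measurable_unit_cube n.
have leb2D : (leb2 D < +oo)%E.
  have lI : leb I01 = 1%E.
    by rewrite lebesgue_measure_itv/= lte_fin ltr01 oppr0 adde0.
  have -> : leb2 D = (leb I01 * lebesgue_tuple R n (@unit_cube R n))%E.
    exact: product_measure1E.
  by rewrite lI mul1e lebesgue_unit_cube ltry.
pose g p := cos (2 * pi * dotZ m (@cons_pair R n p) + c).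
have mg : measurable_fun setT g.
  apply: (measurableT_comp (measurable_cos_dotZ m c)).
  exact: measurable_cons_pair.
have ig : leb2.-integrable D (EFin \o g).
  apply: (@bounded_integrable _ _ _ _ _ mD leb2D _ 1); first exact: measurable_funTS.
  by move=> p _; exact: cos_max.
rewrite [LHS](_ : _ = (\int[pushforward leb2 (@cons_pair R n)]_(y in @unit_cube R n.+1) f y)%E)//.
rewrite integral_pushforward//; last first.
- exact: measurable_unit_cube.
- by rewrite cube_cons.
- exact: measurable_cons_pair.
rewrite cube_cons -/D integral_mkcond.
rewrite -integral21_prod_meas1/=; last by rewrite -integrable_mkcond.
rewrite /fubini_G /=.
transitivity (\int[lebesgue_tuple R n]_(y in @unit_cube R n)
    (if thead m == 0%R then (cos (2 * pi * dotZ [tuple of behead m] y + c))%:E else 0))%E.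
  rewrite [RHS]integral_mkcond; apply: eq_integral => y _.
  rewrite patchE; case: ifPn => yD.
    rewrite -integral_cos_itv [RHS]integral_mkcond; apply: eq_integral => x _.
    rewrite !patchE.
    have -> : ((x, y) \in D) = (x \in I01).
      apply/idP/idP; rewrite !inE; first by case.
      by move=> xI; split => //; move: yD; rewrite inE.
    case: ifP => // _; rewrite /f /= dotZ_cons /=; congr (cos _)%:E; ring.
  rewrite integral0_eq// => x _; rewrite patchE ifF//.
  by apply/negbTE; apply: contra yD; rewrite !inE => -[].
have [m0|m0] := eqVneq (thead m) 0%R.
  rewrite IHn; congr (if _ then _ else _).
  apply/forallP/forallP => mj j.
    case: (unliftP ord0 j) => [k ->|->]; last by rewrite -[tnth _ _]/(thead m) m0.
    by have := mj k; rewrite [in X in _ -> X](tuple_eta m) tnthS.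
  by have := mj (lift ord0 j); rewrite [in X in X -> _](tuple_eta m) tnthS.
rewrite integral0 ifF//; apply/negbTE/forallPn; exists ord0.
exact: m0.
Qed.

End cube_integrals.

(** * Fourier coefficients of the reproducing kernel *)

Section fourier_kernel.
Context (R : realType) (s : nat) (alpha : R) (gamma : {set 'I_s} -> R).
Implicit Types (k l : s.-tuple int) (x y : Rn R s).
Local Notation r := (korobov_r alpha gamma).
Local Notation mu := (lebesgue_tuple R s).
Local Notation cube := (@unit_cube R s).

Definition zero_freq : s.-tuple int := [tuple of nseq s 0].

Lemma zsupport_eq0 k : (zsupport k == finset.set0) = (k == zero_freq).
Proof.
apply/eqP/eqP => [k0|->].
  apply/eq_from_tnth => j; rewrite tnth_nseq.
  by have := finset.in_set0 j; rewrite -k0 inE => /negbFE/eqP.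
by apply/setP => j; rewrite !inE tnth_nseq eqxx.
Qed.

Definition sub_freq k l : s.-tuple int := [tuple tnth k j - tnth l j | j < s].

Lemma dotZ_sub_freq k l x : dotZ (sub_freq k l) x = dotZ k x - dotZ l x.
Proof.
rewrite /dotZ -sumrB; apply: eq_bigr => j _.
by rewrite tnth_mktuple intrD mulrNz mulrBl.
Qed.

Lemma dotZ_subr k x y :
  dotZ k [tuple tnth x j - tnth y j | j < s] = dotZ k x - dotZ k y.
Proof.
rewrite /dotZ -sumrB; apply: eq_bigr => j _.
by rewrite tnth_mktuple mulrBr.
Qed.

Lemma integral_cos_phase k (c : R) :
  \int[mu]_(x in cube) cos (2 * pi * dotZ k x + c) =
  if k == zero_freq then cos c else 0.
Proof.
rewrite /Rintegral integral_cos_cube -zsupport_eq0.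
rewrite (_ : [forall _, _] = (zsupport k == finset.set0)); last first.
  apply/forallP/eqP => [k0|k0 j]; first by apply/setP => j; rewrite !inE k0.
  by have := finset.in_set0 j; rewrite -k0 inE => /negbFE.
by case: ifP.
Qed.

Hypothesis sr : rsummable (fun k => r k ^+ 2).

(** Termwise integration keeps only the term [l = k].  The two values [0] and
    [- pi / 2] of [c] give the real and imaginary parts of the Fourier
    coefficients of the kernel. *)
Lemma integral_kernel_phase k y (c : R) :
  \int[mu]_(x in cube)
    rsum (fun l => r l ^+ 2 * cos (2 * pi * (dotZ l x - dotZ l y) -
                                   2 * pi * dotZ k x + c)) =
  r k ^+ 2 * cos (c - 2 * pi * dotZ k y).
Proof.
have E l x : cos (2 * pi * (dotZ l x - dotZ l y) - 2 * pi * dotZ k x + c) =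
    cos (2 * pi * dotZ (sub_freq l k) x + (c - 2 * pi * dotZ l y)).
  by rewrite dotZ_sub_freq; congr cos; ring.
under eq_Rintegral => x _ do under eq_fun do rewrite E.
have mcube := @measurable_unit_cube R s.
have mufin : (mu cube < +oo)%E by rewrite lebesgue_unit_cube ltry.
rewrite (Rintegral_rsum mcube mufin _ _ _ sr); last 3 first.
- move=> l; apply: measurable_funM => //.
  by apply: measurable_funTS; exact: measurable_cos_dotZ.
- by move=> l x _; rewrite normrM ger0_norm ?sqr_ge0// ler_piMr ?sqr_ge0// cos_max.
- by move=> l; exact: sqr_ge0.
have I l : \int[mu]_(x in cube) (r l ^+ 2 *
     cos (2 * pi * dotZ (sub_freq l k) x + (c - 2 * pi * dotZ l y))) =
   if l == k then r k ^+ 2 * cos (c - 2 * pi * dotZ k y) else 0.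
  rewrite RintegralZl//; last first.
    apply: (bounded_integrable mcube mufin (M := 1)).
      by apply: measurable_funTS; exact: measurable_cos_dotZ.
    by move=> x _; exact: cos_max.
  rewrite integral_cos_phase -zsupport_eq0.
  have -> : (zsupport (sub_freq l k) == finset.set0) = (l == k).
    rewrite zsupport_eq0; apply/eqP/eqP => [lk|->]; apply/eq_from_tnth => j.
      have := congr1 (fun t => tnth t j) lk; rewrite tnth_mktuple tnth_nseq.
      by move/eqP; rewrite subr_eq0 => /eqP.
    by rewrite tnth_mktuple tnth_nseq subrr.
  by case: ifP => [/eqP ->//|_]; rewrite mulr0.
under [fun l => _]eq_fun do rewrite I.
by rewrite (rsum_single (k0 := k)) ?eqxx// => l /negbTE ->.
Qed.

Lemma fourier_kernel y k :
  fourier (korobov_kernel alpha gamma ^~ y) k =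
  ((r k ^+ 2)%:C * (wave k y)^*)%C.
Proof.
have sM (h : s.-tuple int -> R) : (forall l, `|h l| <= 1) ->
    rsummable (fun l => r l ^+ 2 * h l).
  move=> h1; apply: rsummable_le sr => l.
  by rewrite normrM ger0_norm ?sqr_ge0// ler_piMr ?sqr_ge0.
pose A l x := 2 * pi * (dotZ l x - dotZ l y).
pose B x := 2 * pi * dotZ k x.
have ReK x : complex.Re (korobov_kernel alpha gamma x y) =
    rsum (fun l => r l ^+ 2 * cos (A l x)).
  rewrite /=; congr rsum; apply/funext => l.
  by rewrite dotZ_subr mul0r subr0.
have ImK x : complex.Im (korobov_kernel alpha gamma x y) =
    rsum (fun l => r l ^+ 2 * sin (A l x)).
  rewrite /=; congr rsum; apply/funext => l.
  by rewrite dotZ_subr mul0r addr0.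
have cE x : rsummable (fun l => r l ^+ 2 * cos (A l x)).
  by apply: sM => l; exact: cos_max.
have sE x : rsummable (fun l => r l ^+ 2 * sin (A l x)).
  by apply: sM => l; exact: sin_max.
have ReE x : complex.Re (korobov_kernel alpha gamma x y * (wave k x)^*)%C =
    rsum (fun l => r l ^+ 2 * cos (A l x - B x + 0)).
  transitivity (complex.Re (korobov_kernel alpha gamma x y) * cos (B x) +
                complex.Im (korobov_kernel alpha gamma x y) * sin (B x)).
    by case: (korobov_kernel _ _ _ _) => a b /=; rewrite mulrN opprK.
  rewrite ReK ImK mulrC -rsumZ// mulrC -rsumZ// -rsumD//; try exact: rsummableZ.
  by congr rsum; apply/funext => l; rewrite addr0 cosB; ring.
have ImE x : complex.Im (korobov_kernel alpha gamma x y * (wave k x)^*)%C =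
    rsum (fun l => r l ^+ 2 * cos (A l x - B x + - (pi / 2))).
  transitivity (complex.Im (korobov_kernel alpha gamma x y) * cos (B x) +
                (- complex.Re (korobov_kernel alpha gamma x y)) * sin (B x)).
    by case: (korobov_kernel _ _ _ _) => a b /=; rewrite mulrN mulNr addrC.
  rewrite ReK ImK mulrC -rsumZ// mulNr -mulrN mulrC -rsumZ// -rsumD//; try exact: rsummableZ.
  by congr rsum; apply/funext => l; rewrite cosBpihalf sinB; ring.
rewrite /fourier /cintegral /Iint.
under eq_Rintegral do rewrite ReE.
under [X in Complex _ X]eq_Rintegral do rewrite ImE.
rewrite !integral_kernel_phase.
rewrite sub0r cosN /= addrC cosBpihalf sinN /wave /expi /=.
by apply/eqP; rewrite eq_complex /= !mul0r subr0 addr0 !eqxx.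
Qed.

End fourier_kernel.

(** * Averages of exponentials over a rank-1 lattice *)

Section lattice_sums.
Context (R : realType) (N s : nat).
Hypothesis N0 : (0 < N)%N.
Implicit Types (k : s.-tuple int) (z : s.-tuple 'I_N).

Definition lattice_dot k z : int := \sum_(j < s) tnth k j * (tnth z j : nat)%:Z.

(** Membership in the dual lattice of [lattice z]. *)
Definition dual k z : bool := (N%:Z %| lattice_dot k z)%Z.

Lemma lattice_point_in_cube z n : unit_cube (lattice_point R z n).
Proof.
move=> j; rewrite tnth_mktuple /frac_part subr_ge0 floor_le /=.
by rewrite ltrBlDl; have := floorD1_gt ((n * tnth z j)%:R / N%:R : R); rewrite intrD.
Qed.

(** Fractional parts may be dropped up to an integer, which exponentials do not
    see. *)
Lemma dotZ_lattice_point k z n : exists m : int,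
  dotZ k (lattice_point R z n) = n%:R * ((lattice_dot k z)%:~R / N%:R) + m%:~R.
Proof.
exists (- \sum_(j < s) tnth k j * Num.floor ((n * tnth z j)%:R / N%:R : R)).
rewrite /dotZ /lattice_dot mulrNz !raddf_sum/= mulr_suml mulr_sumr. rewrite -big_split/=.
apply: eq_bigr => j _; rewrite tnth_mktuple /frac_part !intrM natrM mulrBr.
by congr (_ - _); rewrite -pmulrn; ring.
Qed.

Lemma expiD (t u : R) : expi (t + u) = expi t * expi u.
Proof.
apply/eqP; rewrite eq_complex /= cosD sinD; apply/andP; split=> //.
by rewrite addrC.
Qed.

Lemma expi0 : expi (0 : R) = 1.
Proof. by rewrite /expi cos0 sin0. Qed.

Lemma expi_natM n (t : R) : expi (n%:R * t) = expi t ^+ n.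
Proof.
elim: n => [|n IHn]; first by rewrite mul0r expi0 expr0.
by rewrite exprS -IHn -expiD mulrSr mulrDl mul1r addrC.
Qed.

Lemma expi_int (t : R) (m : int) : expi (t + 2 * pi * m%:~R) = expi t.
Proof. by rewrite /expi periodic_cos_int periodic_sin_int. Qed.

(** Reducing [M] modulo [N] brings the angle into [0, 2 pi[, where the half angle
    has a positive sine unless it vanishes. *)
Lemma expi_rat_eq1 (M : int) :
  (expi (2 * pi * (M%:~R / N%:R) : R) == 1) = (N%:Z %| M)%Z.
Proof.
have NR : N%:R != 0 :> R by rewrite pnatr_eq0 -lt0n.
have -> : 2 * pi * (M%:~R / N%:R) = 2 * pi * ((M %% N%:Z)%Z%:~R / N%:R) +
    2 * pi * (M %/ N%:Z)%Z%:~R :> R.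
  by rewrite {1}(divz_eq M N%:Z) intrD intrM -pmulrn; field.
rewrite expi_int.
apply/idP/idP => [|/dvdz_mod0P ->]; last by rewrite !mul0r mulr0 expi0.
have m0 : 0 <= (M %% N%:Z)%Z by rewrite modz_ge0// eqz_nat -lt0n.
have mN : (M %% N%:Z)%Z < N%:Z by rewrite ltz_pmod// ltz_nat.
apply: contraLR => mz.
have {}mz : (M %% N%:Z)%Z != 0 by apply: contra mz => /eqP/dvdz_mod0P.
rewrite eq_complex /= negb_and; apply/orP; left.
pose t : R := pi * ((M %% N%:Z)%Z%:~R / N%:R).
have -> : 2 * pi * ((M %% N%:Z)%Z%:~R / N%:R) = t *+ 2.
  by rewrite /t -mulrA mulr_natl mulrA.
(* If the cosine of [2 t] were 1, the sine of [t] would vanish. *)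
have : 0 < sin t.
  apply: sin_gt0_pi; rewrite /t mulr_gt0 ?pi_gt0//=; last first.
    by rewrite divr_gt0 ?ltr0n// ltr0z lt_neqAle eq_sym mz.
  rewrite gtr_pMr ?pi_gt0// ltr_pdivrMr ?ltr0n// mul1r.
  by rewrite [X in _ < X]pmulrn ltr_int.
move=> st; rewrite cos_mulr2n; apply/negP => /eqP h.
have c2 : cos t ^+ 2 = 1 by lra.
by have := sin2cos2 t; rewrite c2 subrr => /eqP; rewrite sqrf_eq0 gt_eqF.
Qed.

(** The values of the exponential along the lattice form a geometric progression
    whose ratio is an [N]-th root of unity. *)
Lemma sum_wave_lattice k z :
  \sum_(x <- lattice R z) wave k x = if dual k z then N%:R else 0.
Proof.
set q := expi (2 * pi * ((lattice_dot k z)%:~R / N%:R) : R).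
have -> : \sum_(x <- lattice R z) wave k x = \sum_(n < N) q ^+ n.
  rewrite /lattice big_map -{1}(subn0 N) -/(index_iota 0 N) big_mkord.
  apply: eq_bigr => n _; rewrite /wave.
  have [m ->] := dotZ_lattice_point k z n.
  by rewrite mulrDr expi_int mulrCA expi_natM.
rewrite /dual -expi_rat_eq1 -/q; case: eqVneq => [->|q1].
  by under eq_bigr do rewrite expr1n; rewrite sumr_const card_ord.
apply/eqP; rewrite -(mulrI_eq0 _ (lregP (_ : q - 1 != 0))) ?subr_eq0//.
(* The ratio [q] satisfies [q ^ N = 1], hence [q - 1] kills the sum. *)
have E : N%:R * (2 * pi * ((lattice_dot k z)%:~R / N%:R)) =
    0 + 2 * pi * (lattice_dot k z)%:~R :> R.
  by field; rewrite pnatr_eq0 -lt0n.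
by rewrite -subrX1 subr_eq0 /q -expi_natM E expi_int expi0.
Qed.

End lattice_sums.

(** * The error of a single lattice rule *)

Section lattice_rule_error.
Context (R : realType) (N s : nat) (alpha : R) (gamma : {set 'I_s} -> R).
Hypothesis N0 : (0 < N)%N.
Implicit Types (k : s.-tuple int) (z : s.-tuple 'I_N).
Local Notation r := (korobov_r alpha gamma).
Hypothesis gamma_gt0 : forall u, 0 < gamma u.
Hypothesis sr : rsummable (fun k => r k ^+ 2).

Lemma korobov_r_gt0 k : 0 < r k.
Proof.
rewrite mulr_gt0// prodr_gt0// => j; rewrite inE => kj.
by rewrite powR_gt0// ltr0z normr_gt0.
Qed.

(** The summand of the squared worst-case error of a lattice rule. *)
Definition dual_weight k z : R :=
  if (zsupport k != finset.set0) && dual k z then r k ^+ 2 else 0.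

Lemma dual_weight_ge0 k z : 0 <= dual_weight k z.
Proof. by rewrite /dual_weight; case: ifP => // _; exact: sqr_ge0. Qed.

Lemma rsummable_dual_weight z : rsummable (dual_weight ^~ z).
Proof.
apply: rsummable_le sr => k; rewrite ger0_norm ?dual_weight_ge0//.
by rewrite /dual_weight; case: ifP => // _; exact: sqr_ge0.
Qed.

Variable f : Rn R s -> R.
Hypothesis Kf : korobov_space alpha gamma f.
Local Notation fhat := (fourier (to_complex f)).

(** The summand of the squared norm of [f]. *)
Definition energy k : R :=
  (complex.Re (fhat k) ^+ 2 + complex.Im (fhat k) ^+ 2) / r k ^+ 2.

Lemma energy_ge0 k : 0 <= energy k.
Proof. by rewrite divr_ge0 ?addr_ge0 ?sqr_ge0. Qed.

Lemma energyE k :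
  energy k = complex.Re (korobov_term alpha gamma (to_complex f) (to_complex f) k).
Proof.
have r0 : r k != 0 by rewrite gt_eqF// korobov_r_gt0.
rewrite /energy /korobov_term; case: (fhat k) => a b /=.
by field.
Qed.

Lemma rsummable_energy : rsummable energy.
Proof.
case: Kf => _ [+ _] _; congr summable; apply/funext => k /=.
by rewrite energyE.
Qed.

(** The arithmetic-geometric inequality for [|fhat k| / rho] and [rho], where
    [rho] is [korobov_r alpha gamma k].  With the
    parameter [t] free, it yields absolute convergence of the Fourier series and
    replaces the Cauchy-Schwarz inequality. *)
Lemma coef_le_energy k (t : R) : 0 < t ->
  `|complex.Re (fhat k)| <= 2^-1 * (t * energy k + r k ^+ 2 / t) /\
  `|complex.Im (fhat k)| <= 2^-1 * (t * energy k + r k ^+ 2 / t).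
Proof.
move=> t0; have r0 := korobov_r_gt0 k.
have H (a b : R) : `|a| <= 2^-1 * (t * ((a ^+ 2 + b ^+ 2) / r k ^+ 2) + r k ^+ 2 / t).
  set rho := r k in r0 *.
  have E : 2^-1 * (t * ((a ^+ 2 + b ^+ 2) / rho ^+ 2) + rho ^+ 2 / t) - `|a| =
     2^-1 / (t * rho ^+ 2) * ((t * `|a| - rho ^+ 2) ^+ 2 + t ^+ 2 * b ^+ 2).
    rewrite -[a ^+ 2]real_normK ?num_real//; field.
    by rewrite !gt_eqF.
  rewrite -subr_ge0 E; apply: mulr_ge0.
    by rewrite divr_ge0// mulr_ge0 ?sqr_ge0// ltW.
  by rewrite addr_ge0 ?sqr_ge0// mulr_ge0 ?sqr_ge0.
split; rewrite /energy; first exact: H.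
by rewrite [X in X / _]addrC; exact: H.
Qed.

Lemma rsummable_coef : rsummable (fun k => `|complex.Re (fhat k)|) /\
  rsummable (fun k => `|complex.Im (fhat k)|).
Proof.
have S : rsummable (fun k => 2^-1 * (1 * energy k + r k ^+ 2 / 1)).
  apply: rsummableZ; apply: rsummableD; first exact/rsummableZ/rsummable_energy.
  by under [fun k => _]eq_fun do rewrite divr1.
by split; apply: rsummable_le S => k; rewrite normr_id;
  have [] := coef_le_energy k ltr01.
Qed.

(** The Fourier series of [f] represents [f] at every point, which is what the
    reproducing property says once the kernel coefficients are known. *)
Lemma fourier_inversion y : unit_cube y ->
  f y = rsum (fun k => complex.Re (fhat k * wave k y)).
Proof.
move=> cy; case: Kf => _ _ /(_ y cy) E.
transitivity (rsum (fun k => complex.Re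
  (korobov_term alpha gamma (to_complex f) (korobov_kernel alpha gamma ^~ y) k))).
  exact: (congr1 (@complex.Re R) E).
congr rsum; apply/funext => k; congr (complex.Re _).
have r0 : r k != 0 by rewrite gt_eqF// korobov_r_gt0.
rewrite /korobov_term fourier_kernel// /wave /expi; case: (fhat k) => a b.
by apply/eqP; rewrite eq_complex /=; apply/andP; split; apply/eqP; field.
Qed.

Lemma Iint_fourier : Iint f = complex.Re (fhat (zero_freq s)).
Proof.
rewrite /fourier /cintegral /=; congr Iint; apply/funext => x.
have -> : dotZ (zero_freq s) x = 0 by rewrite /dotZ big1// => j _; rewrite tnth_nseq mul0r.
by rewrite mulr0 cos0 mulr1 mul0r subr0.
Qed.

Lemma Qrule_fourier z : Qrule (lattice R z) f =
  rsum (fun k => if dual k z then complex.Re (fhat k) else 0).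
Proof.
have [sRe sIm] := rsummable_coef.
have sw y : rsummable (fun k => complex.Re (fhat k * wave k y)).
  apply: rsummable_le (rsummableD sRe sIm) => k.
  rewrite /wave /expi; case: (fhat k) => a b /=.
  rewrite (le_trans (ler_normB _ _))// !normrM lerD// ler_piMr//.
    exact: cos_max.
  exact: sin_max.
rewrite /Qrule.
have -> : \sum_(x <- lattice R z) f x =
    \sum_(x <- lattice R z) rsum (fun k => complex.Re (fhat k * wave k x)).
  rewrite big_seq [RHS]big_seq; apply: eq_bigr => x /mapP [n _ ->].
  exact/fourier_inversion/lattice_point_in_cube.
have [s1 s2] := rsum_sum (lattice R z) sw.
rewrite -s2 -rsumZ//; congr rsum; apply/funext => k.
rewrite -raddf_sum -mulr_sumr sum_wave_lattice// size_map size_iota.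
have NR : N%:R != 0 :> R by rewrite pnatr_eq0 -lt0n.
case: ifP => _; last by rewrite !mulr0.
by rewrite mulr_natr raddfMn -[X in _ * X]mulr_natl mulKf.
Qed.

(** The error is the sum of the coefficients over the nonzero dual frequencies.
    Each is at most half of [B * energy k + dual_weight k z / B], and both parts
    sum to at most [B]. *)
Lemma Qrule_error z (B : R) : 0 < B -> rsum (dual_weight ^~ z) <= B ^+ 2 ->
  korobov_norm alpha gamma f <= 1 -> `|Qrule (lattice R z) f - Iint f| <= B.
Proof.
move=> B0 SB fle1.
have fl : rsum energy <= 1.
  have : Num.sqrt (rsum energy) <= 1.
    apply: le_trans fle1; rewrite /korobov_norm /=.
    rewrite (_ : energy = fun k => complex.Re
      (korobov_term alpha gamma (to_complex f) (to_complex f) k))//.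
    by apply/funext => k; rewrite energyE.
  by rewrite -[X in _ <= X]sqrtr1 ler_sqrt.
have [sRe _] := rsummable_coef.
(* [b] is the Fourier side of the error; [e0] isolates the integral of [f]. *)
pose b k := if (zsupport k != finset.set0) && dual k z then complex.Re (fhat k) else 0.
have sb : rsummable b.
  apply: rsummable_le sRe => k; rewrite /b; case: ifP => //.
  by rewrite normr0.
pose e0 k := if k == zero_freq s then complex.Re (fhat k) else 0.
have se0 : rsummable e0.
  apply: rsummable_le sRe => k; rewrite /e0; case: ifP => //.
  by rewrite normr0.
have -> : Qrule (lattice R z) f - Iint f = rsum b.
  rewrite Qrule_fourier Iint_fourier.
  have -> : complex.Re (fhat (zero_freq s)) = rsum e0.
    by rewrite (rsum_single (k0 := zero_freq s)) /e0 ?eqxx// => k /negbTE ->.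
  apply/eqP; rewrite subr_eq -rsumD//; apply/eqP; congr rsum; apply/funext => k.
  rewrite /b /e0 zsupport_eq0; case: eqVneq => [->|] /=; last by rewrite addr0.
  rewrite add0r ifT// /dual /lattice_dot big1 ?dvdz0// => j _.
  by rewrite tnth_nseq mul0r.
have sE := rsummable_energy.
have sW := rsummable_dual_weight z.
have s1 := rsummableZ B sE; have s2 := rsummableZ B^-1 sW.
have sM := rsummableZ 2^-1 (rsummableD s1 s2).
have bM k : `|b k| <= 2^-1 * (B * energy k + B^-1 * dual_weight k z).
  rewrite /b /dual_weight; case: ifP => _.
    by rewrite [B^-1 * _]mulrC; have [] := coef_le_energy k B0.
  rewrite normr0 mulr0 addr0; apply: mulr_ge0; first by rewrite invr_ge0.
  by rewrite mulr_ge0 ?energy_ge0// ltW.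
have M1 : rsum (fun k => 2^-1 * (B * energy k + B^-1 * dual_weight k z)) <= B.
  rewrite (rsumZ _ (rsummableD s1 s2)) (rsumD s1 s2) (rsumZ _ sE) (rsumZ _ sW).
  have h1 : B * rsum energy <= B by rewrite ler_piMr// ltW.
  have h2 : B^-1 * rsum (dual_weight ^~ z) <= B.
    by rewrite ler_pdivrMl// -expr2.
  lra.
rewrite ler_norml; apply/andP; split.
  rewrite lerNl -mulN1r -rsumZ//; apply: le_trans M1; apply: ler_rsum => //.
    exact: rsummableZ.
  by move=> k; rewrite mulN1r (le_trans _ (bM k))// -normrN ler_norm.
apply: le_trans M1; apply: ler_rsum => // k.
by rewrite (le_trans _ (bM k))// ler_norm.
Qed.

End lattice_rule_error.

(** * The median *)

Section median.
Context (R : realType).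

(** If more than half of the values lie in an interval, the values on either side
    of it are too few to reach the middle position. *)
Lemma median_between (v : seq R) (lo hi : R) :
  ((size v)./2 < count (fun x => (lo <= x <= hi)%R) v)%N -> odd (size v) ->
  lo <= median v <= hi.
Proof.
move=> cv ov; rewrite /median; set t := sort <=%R v.
have st : sorted <=%O t by exact: sort_le_sorted.
have pt : perm_eq t v by rewrite perm_sort.
have sz : size t = size v by rewrite size_sort.
have cc p : count p t = count p v by apply/permP.
apply/andP; split; last first.
  apply: nth_count_le => //; rewrite cc; apply: leq_trans cv _.
  by apply: sub_count => x /andP[].
apply: nth_count_ge => //; rewrite cc sz; apply/andP; split; last first.
  by rewrite ltn_half_double -addnn -{1}(add0n (size v)) ltn_add2r; case: (size v) ov.
rewrite (eq_count (a2 := fun x => x < lo))//.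
have e : (count (fun x => (x < lo)%R) v + count (fun x => (lo <= x)%R) v = size v)%N.
  rewrite -(count_predC (fun x => x < lo) v); congr addn.
  by apply: eq_count => x; rewrite /= leNgt.
have h : (count (fun x => (lo <= x <= hi)%R) v <= count (fun x => (lo <= x)%R) v)%N.
  by apply: sub_count => x /andP[].
have := odd_double_half (size v); rewrite ov -addnn.
by move: cv e h; lia.
Qed.

(** The good indices do not depend on the integrand, so one majority serves all
    functions of the unit ball. *)
Lemma worst_case_error_median N s r (alpha : R) (gamma : {set 'I_s} -> R)
    (z : 'I_r -> s.-tuple 'I_N) (B : R) :
  (0 < N)%N -> (forall u, 0 < gamma u) ->
  rsummable (fun k => korobov_r alpha gamma k ^+ 2) ->
  odd r -> 0 < B ->
  (r./2 < #|[pred i | (rsum (dual_weight alpha gamma ^~ (z i)) <= B ^+ 2)%R]|)%N ->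
  (worst_case_error alpha gamma (median_rule z) <= B%:E)%E.
Proof.
move=> N0 g0 sr oddr B0 maj; apply: ge_ereal_sup => _ [f [Kf f1] <-].
rewrite lee_fin; set v := [seq Qrule (lattice R (z i)) f | i <- enum 'I_r].
have sv : size v = r by rewrite size_map size_enum_ord.
suff : Iint f - B <= median v <= Iint f + B.
  by case/andP=> h1 h2; rewrite ler_norml /median_rule -/v; apply/andP; split; lra.
apply: median_between; rewrite sv//.
apply: (leq_trans maj); rewrite count_map.
have -> (A : pred 'I_r) : #|A| = count A (enum 'I_r).
  by rewrite cardE enumT -size_filter.
apply: sub_count => i; rewrite /= => Si.
have := Qrule_error N0 g0 sr Kf B0 Si f1; rewrite ler_norml => /andP[h1 h2].
by apply/andP; split; lra.
Qed.

End median.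

(** * Zeta sums *)

Section zeta_sums.
Context (R : realType).
Implicit Types (a : R) (k : int).

(** Compares the term with the increment of the primitive of [x ^ - a], so that
    the sum telescopes; it comes from [1 + y <= expR y] and [ln (1 - x) <= - x]. *)
Lemma riemann_term_le a n : 1 < a ->
  (n.+2)%:R `^ (- a) <=
  (a - 1)^-1 * ((n.+1)%:R `^ (- (a - 1)) - (n.+2)%:R `^ (- (a - 1))) :> R.
Proof.
move=> a1; set b := a - 1; have b0 : 0 < b by rewrite subr_gt0.
have n1 : 0 < n.+1%:R :> R by rewrite ltr0n.
have n2 : 0 < n.+2%:R :> R by rewrite ltr0n.
rewrite mulrC ler_pdivlMr//.
have -> : (- a) = - b + - 1 :> R by rewrite /b; ring.
rewrite powRD; last by rewrite (gt_eqF n2) implybT.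
rewrite powR_inv1; last exact: ltW.
have -> : n.+1%:R = n.+2%:R * (1 - n.+2%:R^-1) :> R.
  by rewrite mulrBr mulr1 mulfV ?gt_eqF// -[n.+2%:R]natr1 addrK.
set x : R := n.+2%:R in n2 *.
have x1 : 0 < 1 - x^-1.
  by rewrite subr_gt0 invf_lt1// /x ltr1n.
rewrite powRM; [|exact: ltW|exact: ltW].
have -> : x `^ (- b) * (1 - x^-1) `^ (- b) - x `^ (- b) =
    x `^ (- b) * ((1 - x^-1) `^ (- b) - 1) by ring.
rewrite -mulrA ler_pM2l ?powR_gt0// lerBrDr /powR gt_eqF//.
apply: le_trans (expR_ge1Dx _).
rewrite addrC lerD2l mulNr -mulrN mulrC ler_pM2l// lerNr.
by apply: le_ln1Dx; rewrite ltrN2 invf_lt1// /x ltr1n.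
Qed.

Lemma cvg_zeta a : 1 < a ->
  cvgn (series (fun n => (n.+1)%:R `^ (- a) : R)).
Proof.
move=> a1; have b0 : 0 < a - 1 by rewrite subr_gt0.
apply: nondecreasing_is_cvgn.
  by apply: nondecreasing_series => n _ _; exact: powR_ge0.
exists (1 + (a - 1)^-1) => _ [n _ <-].
suff H m : series (fun n => n.+1%:R `^ (- a) : R) m.+1 <=
    1 + (a - 1)^-1 * (1 - m.+1%:R `^ (- (a - 1))).
  apply: (@le_trans _ _ (series (fun n => n.+1%:R `^ (- a) : R) n.+1)).
    by rewrite seriesSr lerDl powR_ge0.
  apply: (le_trans (H n)); rewrite lerD2l -[X in _ <= X]mulr1 ler_pM2l ?invr_gt0//.
elim: m => [|m IH].
  by rewrite seriesSr /series /= big_geq// add0r !powR1 subrr mulr0 addr0.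
rewrite seriesSr; apply: (le_trans (lerD IH (riemann_term_le m a1))).
by rewrite -addrA -mulrDr addrA subrK.
Qed.

Lemma zeta_gt0 a : 1 < a -> 0 < zeta a.
Proof.
move=> a1; apply: (@lt_le_trans _ _ 1) => //.
have -> : 1 = series (fun n => (n.+1)%:R `^ (- a) : R) 1.
  by rewrite seriesSr /series /= big_geq// add0r powR1.
apply: nondecreasing_cvgn_le; last exact: cvg_zeta.
by apply: nondecreasing_series => n _ _; exact: powR_ge0.
Qed.

Lemma esum_zeta a : 1 < a ->
  (\esum_(n in [set: nat]) ((n.+1)%:R `^ (- a))%:E = (zeta a)%:E)%E.
Proof.
move=> a1; rewrite -nneseries_esumT => [|n]; last by rewrite lee_fin powR_ge0.
rewrite /zeta -EFin_lim; last exact: cvg_zeta.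
by apply/congr_lim/funext => n /=; rewrite sumEFin.
Qed.

(** The value at 0 is set to 0, so that sums over nonzero integers become sums
    over [int]. *)
Definition abs_powN a k : R := if k == 0 then 0 else `|k|%:~R `^ (- a).

Lemma abs_powN_ge0 a k : 0 <= abs_powN a k.
Proof. by rewrite /abs_powN; case: ifP => // _; exact: powR_ge0. Qed.

Lemma esum_abs_powN a : 1 < a ->
  (\esum_(k in [set: int]) (abs_powN a k)%:E = (2 * zeta a)%:E)%E.
Proof.
move=> a1.
pose P := range (fun n : nat => n.+1%:Z); pose M := range Negz.
have pP k : (k \in P) = (0 < k).
  apply/idP/idP; first by rewrite inE => -[n _ <-].
  by case: k => [[//|n]|//] _; rewrite inE; exists n.
have pM k : (k \in M) = (k < 0).
  apply/idP/idP; first by rewrite inE => -[n _ <-].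
  by case: k => [//|n] _; rewrite inE; exists n.
have -> : (\esum_(k in [set: int]) (abs_powN a k)%:E =
   \esum_(k in P) (abs_powN a k)%:E + \esum_(k in M) (abs_powN a k)%:E)%E.
  rewrite [X in (X + _)%E]esum_mkcond [X in (_ + X)%E]esum_mkcond -esumD.
  - apply: eq_esum => k _; rewrite pP pM /abs_powN.
    by case: ltrgt0P; rewrite ?adde0 ?add0e.
  - by move=> k _; case: ifP => // _; rewrite lee_fin abs_powN_ge0.
  - by move=> k _; case: ifP => // _; rewrite lee_fin abs_powN_ge0.
rewrite !esum_image; [|by move=> m n _ _ []..].
rewrite mulr_natl mulr2n EFinD -esum_zeta//; congr (_ + _)%E.
Qed.

Lemma esum_abs_powN_dvd a (d : nat) : 1 < a -> (0 < d)%N ->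
  (\esum_(k in [set: int]) (if (d%:Z %| k)%Z then abs_powN a k else 0)%:E =
   (d%:R `^ (- a) * (2 * zeta a))%:E)%E.
Proof.
move=> a1 d0; have dz : d%:Z != 0 by lia.
pose D := range (fun k : int => k * d%:Z).
have -> : (\esum_(k in [set: int]) (if (d%:Z %| k)%Z then abs_powN a k else 0)%:E =
    \esum_(k in D) (abs_powN a k)%:E)%E.
  rewrite [RHS]esum_mkcond; apply: eq_esum => k _.
  have -> : (k \in D) = (d%:Z %| k)%Z.
    apply/idP/idP; rewrite inE; first by case=> q _ <-; exact: dvdz_mull.
    by move=> /dvdzP [q ->]; exists q.
  by case: ifP.
rewrite esum_image; last first.
  by move=> x y _ _; apply: mulIf.
rewrite EFinM -esum_abs_powN// -esumZl ?powR_ge0//; last first.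
  by move=> k; rewrite lee_fin abs_powN_ge0.
apply: eq_esum => k _; rewrite -EFinM /abs_powN mulf_eq0 (negbTE dz) orbF.
case: eqP => [_|_]; first by rewrite mulr0.
by rewrite normrM intrM powRM ?ler0z// mulrC.
Qed.

End zeta_sums.

(** * Solutions of a linear congruence among the units *)

Section residue_count.
Variable N : nat.
Hypothesis N0 : (0 < N)%N.

(** If [z0] is a unit solution, then [d := gcd(c, N)] divides [k * z0], hence [k].
    The solutions are congruent modulo [N / gcd(k, N)], so there are at most
    [gcd(k, N)] of them, and [gcd(k, N)] divides [c], hence [d]. *)
Lemma card_unit_solutions (k c : int) :
  (#|[pred z in unit_residues N | (N%:Z %| (k * (z : nat)%:Z + c)%R)%Z]| <=
   if (gcdz c N%:Z %| k)%Z then `|gcdz c N%:Z|%N else 0)%N.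
Proof.
set A := [pred z in _ | _]; set d := gcdz c N.
have dgt0 : (0 < `|d|)%N by rewrite absz_gt0 gcdz_eq0 negb_and; apply/orP; right; lia.
have [[z0 Az0]|A0] := pselect (exists z0, A z0); last first.
  rewrite eq_card0 => [|z]; first by case: ifP.
  by apply/negbTE/negP => Az; apply: A0; exists z.
have dN : (d %| N%:Z)%Z by exact: dvdz_gcdr.
have dc : (d %| c)%Z by exact: dvdz_gcdl.
move: (Az0) => /andP[]; rewrite inE => /andP[_ cz0] Nz0.
have dk : (d %| k)%Z.
  have : (d %| k * (z0 : nat)%:Z)%Z.
    have -> : k * (z0 : nat)%:Z = k * (z0 : nat)%:Z + c - c by rewrite addrK.
    by rewrite rpredB// (dvdz_trans dN).
  rewrite mulrC Gauss_dvdzr// coprimezE /=.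
  by rewrite coprime_sym; apply: (@coprime_dvdr _ _ _ dN).
rewrite dk.
set g := gcdn `|k| N; pose m := (N %/ g)%N.
have gN : (g %| N)%N by exact: dvdn_gcdr.
have g0 : (0 < g)%N by exact: dvdn_gt0 gN.
have m0 : (0 < m)%N by rewrite divn_gt0// dvdn_leq.
have Nmg : (N = m * g)%N by rewrite divnK.
have gd : (g <= `|d|)%N.
  apply: dvdn_leq => //.
  suff : (g%:Z %| d)%Z by [].
  rewrite dvdz_gcd; apply/andP; split; last by rewrite dvdzE.
  have -> : c = k * (z0 : nat)%:Z + c - k * (z0 : nat)%:Z by rewrite addrC addKr.
  rewrite rpredB//; first by apply: dvdz_trans Nz0; rewrite dvdzE.
  by rewrite dvdz_mulr// dvdzE dvdn_gcdl.
apply: leq_trans gd.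
have cmk : coprime m (`|k| %/ g).
  rewrite /coprime -(eqn_pmul2r g0) muln_gcdl -Nmg divnK ?dvdn_gcdl//.
  by rewrite gcdnC mul1n.
have Am z : A z -> (m%:Z %| (z : nat)%:Z - (z0 : nat)%:Z)%Z.
  move=> /andP[_ Nz].
  have : (N%:Z %| k * ((z : nat)%:Z - (z0 : nat)%:Z))%Z.
    have -> : k * ((z : nat)%:Z - (z0 : nat)%:Z) =
      (k * (z : nat)%:Z + c) - (k * (z0 : nat)%:Z + c) by ring.
    exact: rpredB.
  rewrite !dvdzE abszM /= {1}Nmg -{1}(divnK (dvdn_gcdl `|k| N)) -/g.
  by rewrite mulnAC dvdn_pmul2r// Gauss_dvdr.
have [g' gg'] : exists g', g = g'.+1 by exists g.-1; rewrite prednK.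
(* A solution is determined by its quotient by [m], which is less than [g]. *)
pose f (z : 'I_N) : 'I_g'.+1 := inord (z %/ m).
have f_inj : {in A &, injective f}.
  move=> z z' Az Az' /(congr1 val); rewrite /= !inordK; last 2 first.
  - by rewrite -gg' ltn_divLR// mulnC -Nmg.
  - by rewrite -gg' ltn_divLR// mulnC -Nmg.
  move=> eqd; apply: val_inj => /=.
  have : (m%:Z %| (z : nat)%:Z - (z' : nat)%:Z)%Z.
    have -> : (z : nat)%:Z - (z' : nat)%:Z =
      ((z : nat)%:Z - (z0 : nat)%:Z) - ((z' : nat)%:Z - (z0 : nat)%:Z) by ring.
    by apply: rpredB; exact: Am.
  rewrite -eqz_mod_dvd !modz_nat => /eqP [eqm].
  by rewrite (divn_eq z m) (divn_eq z' m) eqd eqm.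
rewrite -(card_in_image f_inj) gg' -[X in (_ <= X)%N]card_ord.
exact: max_card.
Qed.
End residue_count.

Section unit_residue_sums.
Variables (R : realType) (N : nat).
Hypothesis N0 : (0 < N)%N.

(** Counting the units first turns the double sum into [d] times the sum over the
    multiples of [d], that is into [d ^ (1 - a) * 2 zeta(a)], where
    [d = gcd(c, N)]. *)
Lemma sum_unit_abs_powN (a : R) (c : int) : 1 < a ->
  (\sum_(z in unit_residues N) \esum_(k in [set: int])
     (if (N%:Z %| (k * (z : nat)%:Z + c)%R)%Z then abs_powN a k else 0)%:E <=
   (2 * zeta a)%:E)%E.
Proof.
move=> a1; set d := `|gcdz c N%:Z|%N.
have d0 : (0 < d)%N by rewrite absz_gt0 gcdz_eq0 negb_and; apply/orP; right; lia.
rewrite -esum_sum; last first.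
  by move=> k z _ _; case: ifP => // _; rewrite lee_fin abs_powN_ge0.
apply: (@le_trans _ _ (\esum_(k in [set: int])
   (d%:R%:E * (if (d%:Z %| k)%Z then abs_powN a k else 0)%:E))%E).
  apply: le_esum => k _; rewrite sumEFin -EFinM lee_fin.
  rewrite -big_mkcondr/= sumr_const -[X in X <= _]mulr_natl.
  have := card_unit_solutions N0 k c.
  have -> : (gcdz c N %| k)%Z = (d%:Z %| k)%Z by rewrite !dvdzE absz_nat.
  case: ifP => _; last first.
    by rewrite leqn0 => /eqP ->; rewrite mul0r mulr0.
  by move=> h; rewrite ler_wpM2r ?abs_powN_ge0// ler_nat.
rewrite esumZl//; last by move=> k; case: ifP => // _; rewrite lee_fin abs_powN_ge0.
have Z0 : 0 <= 2 * zeta a by rewrite mulr_ge0// ltW// zeta_gt0.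
rewrite esum_abs_powN_dvd// -EFinM lee_fin; move: (2 * zeta a) Z0 => Z Z0.
rewrite mulrA; apply: ler_piMl => //.
have dR : 0 < d%:R :> R by rewrite ltr0n.
rewrite powRN ler_pdivrMr ?powR_gt0// mul1r -{1}(powRr1 (ltW dR)).
by apply: ler_powR; [rewrite ler1n|exact: ltW].
Qed.

End unit_residue_sums.

(** * Sums over tuples *)

Section big_tuples.
Context (V : Type) (idx : V) (op : Monoid.com_law idx).

Lemma big_tuple_cons (T : finType) n (A : {pred T}) (F : n.+1.-tuple T -> V) :
  \big[op/idx]_(t : n.+1.-tuple T | [forall j, tnth t j \in A]) F t =
   \big[op/idx]_(x in A) \big[op/idx]_(t : n.-tuple T | [forall j, tnth t j \in A])
     F [tuple of x :: t].
Proof.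
rewrite pair_big /=.
rewrite (reindex (fun p : T * n.-tuple T => [tuple of p.1 :: p.2])) /=; last first.
  exists (fun t => (thead t, [tuple of behead t])) => [[x t] _|t _] /=.
    by congr pair; exact: val_inj.
  by rewrite -tuple_eta.
apply: eq_bigl => -[x t] /=; apply/forallP/andP => [h|[xA /forallP tA] j].
  split; first exact: (h ord0).
  by apply/forallP => j; have := h (lift ord0 j); rewrite tnthS.
by case: (unliftP ord0 j) => [k ->|->//]; rewrite tnthS.
Qed.

End big_tuples.

Lemma card_tuple_in (T : finType) n (A : {pred T}) :
  #|[pred t : n.-tuple T | [forall j, tnth t j \in A]]| = (#|A| ^ n)%N.
Proof.
elim: n => [|n IHn].
  rewrite expn0 -(card1 ([tuple] : 0.-tuple T)); apply: eq_card => t.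
  by rewrite (tuple0 t) !inE; apply/forallP => -[].
have cE m : #|[pred t : m.-tuple T | [forall j, tnth t j \in A]]| =
    (\sum_(t : m.-tuple T | [forall j, tnth t j \in A]) 1)%N.
  by rewrite sum1_card.
rewrite cE big_tuple_cons /=.
by under eq_bigr do rewrite -cE IHn; rewrite sum_nat_const expnS.
Qed.

Section tuple_sums.
Context (R : realType).

Lemma exchange_esum (S T : choiceType) (a : S -> T -> \bar R) :
  (forall i j, 0 <= a i j)%E ->
  (\esum_(i in [set: S]) \esum_(j in [set: T]) a i j =
   \esum_(j in [set: T]) \esum_(i in [set: S]) a i j)%E.
Proof.
move=> a0; rewrite esum_esum// esum_esum//.
rewrite (reindex_esum ([set: T] `*`` (fun=> [set: S])) _ (fun p => (p.2, p.1)))//.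
split; first by [].
  by move=> [x y] [x' y'] _ _ [-> ->].
by move=> [x y] _; exists (y, x).
Qed.

Lemma esum_tuple_cons (T : choiceType) n (F : n.+1.-tuple T -> \bar R) :
  (forall t, 0 <= F t)%E ->
  (\esum_(t in [set: n.+1.-tuple T]) F t =
   \esum_(x in [set: T]) \esum_(t in [set: n.-tuple T]) F [tuple of x :: t])%E.
Proof.
move=> F0; rewrite esum_esum//.
rewrite (reindex_esum ([set: T] `*`` (fun=> [set: n.-tuple T])) _
  (fun p : T * n.-tuple T => [tuple of p.1 :: p.2]))//.
split; first by [].
  move=> [x t] [x' t'] _ _ /= /(congr1 val) /= [-> tt'].
  by congr pair; exact: val_inj.
by move=> t _; exists (thead t, [tuple of behead t]) => //=; rewrite -tuple_eta.
Qed.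

(** Tonelli for a product of nonnegative functions of the coordinates. *)
Lemma esum_tuple_prod n (g : 'I_n -> int -> R) (G : 'I_n -> R) :
  (forall j k, 0 <= g j k) ->
  (forall j, \esum_(k in [set: int]) (g j k)%:E <= (G j)%:E)%E ->
  (\esum_(t in [set: n.-tuple int]) (\prod_(j < n) g j (tnth t j))%:E <=
   (\prod_(j < n) G j)%:E)%E.
Proof.
elim: n g G => [|n IHn] g G g0 gG.
  rewrite (_ : [set: 0.-tuple int] = [set [tuple]]); last first.
    by apply/seteqP; split => // t _; rewrite (tuple0 t).
  by rewrite esum_set1 !big_ord0 ?lee_fin.
have G0 j : 0 <= G j.
  by rewrite -lee_fin; apply: le_trans (gG j); apply: esum_ge0 => k _; rewrite lee_fin.
rewrite esum_tuple_cons => [|t]; last by rewrite lee_fin prodr_ge0.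
apply: (@le_trans _ _ (\esum_(x in [set: int])
   ((\prod_(j < n) G (lift ord0 j))%:E * (g ord0 x)%:E))%E).
  apply: le_esum => x _.
  have -> : (\esum_(t in [set: n.-tuple int])
       (\prod_(j < n.+1) g j (tnth [tuple of x :: t] j))%:E =
     \esum_(t in [set: n.-tuple int]) ((g ord0 x)%:E *
       (\prod_(j < n) g (lift ord0 j) (tnth t j))%:E))%E.
    apply: eq_esum => t _; rewrite big_ord_recl -EFinM; congr (_ * _)%:E.
    by apply: eq_bigr => j _; rewrite tnthS.
  rewrite esumZl// => [|t]; last by rewrite lee_fin prodr_ge0.
  rewrite muleC lee_wpmul2r ?lee_fin//.
  exact: (IHn (fun j => g (lift ord0 j)) (fun j => G (lift ord0 j))).
rewrite esumZl ?prodr_ge0// => [|k]; last by rewrite lee_fin.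
rewrite big_ord_recl mulrC EFinM lee_wpmul2l ?lee_fin ?prodr_ge0//.
Qed.

End tuple_sums.

(** * Averages over generating vectors *)

Section dual_tuple_sums.
Context (R : realType) (N : nat).
Hypothesis N0 : (0 < N)%N.
Local Notation U := (unit_residues N).

(** A product weight restricted to the solutions [t] of one linear congruence.
    The constant [c] collects the coordinates removed by induction. *)
Definition congr_weight n (g : 'I_n -> int -> R) (c : int)
    (w : n.-tuple 'I_N) (t : n.-tuple int) : R :=
  if (N%:Z %| (lattice_dot t w + c)%R)%Z then \prod_(j < n) g j (tnth t j) else 0.

Lemma congr_weight_ge0 n (g : 'I_n -> int -> R) c w t :
  (forall j k, 0 <= g j k) -> 0 <= congr_weight g c w t.
Proof. by move=> g0; rewrite /congr_weight; case: ifP => // _; rewrite prodr_ge0. Qed.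

Lemma lattice_dot_cons n (t : n.-tuple int) (w : n.-tuple 'I_N) (k : int) (x : 'I_N) :
  lattice_dot [tuple of k :: t] [tuple of x :: w] =
  k * (x : nat)%:Z + lattice_dot t w.
Proof.
rewrite /lattice_dot big_ord_recl; congr (_ + _).
by apply: eq_bigr => j _; rewrite !tnthS.
Qed.

Lemma congr_weight_cons n (g : 'I_n.+1 -> int -> R) (c : int)
    (w : n.-tuple 'I_N) (t : n.-tuple int) (k : int) (x : 'I_N) :
  congr_weight g c [tuple of x :: w] [tuple of k :: t] =
  g ord0 k * congr_weight (fun j => g (lift ord0 j)) (k * (x : nat)%:Z + c) w t.
Proof.
rewrite /congr_weight lattice_dot_cons big_ord_recl.
have -> : \prod_(i < n) g (lift ord0 i) (tnth [tuple of k :: t] (lift ord0 i)) =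
    \prod_(i < n) g (lift ord0 i) (tnth t i).
  by apply: eq_bigr => j _; rewrite tnthS.
rewrite (_ : k * _ + _ + c = lattice_dot t w + (k * (x : nat)%:Z + c)); last by ring.
by case: ifP; rewrite ?mulr0.
Qed.

(** Only the coordinate [j0] has to benefit from the congruence: its estimate
    holds for every right-hand side, so it applies with the other coordinates
    fixed, and these contribute their full sums and a factor [#|U|] each.  The
    induction removes the first coordinate, which either is [j0] and is summed
    first, or is summed last. *)
Lemma sum_esum_congr_weight n (g : 'I_n -> int -> R) (G : 'I_n -> R) (j0 : 'I_n) :
  (forall j k, 0 <= g j k) ->
  (forall j, \esum_(k in [set: int]) (g j k)%:E <= (G j)%:E)%E ->
  (forall c : int, \sum_(z in U) \esum_(k in [set: int])
     (if (N%:Z %| (k * (z : nat)%:Z + c)%R)%Z then g j0 k else 0)%:E <= (G j0)%:E)%E ->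
  forall c : int,
  (\sum_(w : n.-tuple 'I_N | [forall j, tnth w j \in U])
     \esum_(t in [set: n.-tuple int]) (congr_weight g c w t)%:E <=
   ((#|U| ^ n.-1)%:R * \prod_(j < n) G j)%:E)%E.
Proof.
elim: n g G j0 => [|n IHn] g G j0; [by case: j0|move=> g0 gG gj0 c].
have G0 j : 0 <= G j.
  by rewrite -lee_fin; apply: le_trans (gG j); apply: esum_ge0 => k _; rewrite lee_fin.
pose g' j := g (lift ord0 j); pose G' j := G (lift ord0 j).
have prodE : \prod_(j < n.+1) G j = G ord0 * \prod_(j < n) G' j.
  by rewrite big_ord_recl.
have W0 h e v t : (0 <= (@congr_weight n (fun j => g (lift ord0 j)) h e t)%:E)%E.
  by rewrite lee_fin congr_weight_ge0.
rewrite big_tuple_cons /=.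
have -> : (\sum_(x in U) \sum_(w : n.-tuple 'I_N | [forall j, tnth w j \in U])
     \esum_(t in [set: n.+1.-tuple int]) (congr_weight g c [tuple of x :: w] t)%:E =
   \sum_(x in U) \sum_(w : n.-tuple 'I_N | [forall j, tnth w j \in U])
     \esum_(k in [set: int]) \esum_(t in [set: n.-tuple int])
       (g ord0 k * congr_weight g' (k * (x : nat)%:Z + c) w t)%:E)%E.
  apply: eq_bigr => x _; apply: eq_bigr => w _.
  rewrite esum_tuple_cons => [|t]; last by rewrite lee_fin congr_weight_ge0.
  by apply: eq_esum => k _; apply: eq_esum => t _; rewrite congr_weight_cons.
have gW0 k x w t : (0 <= (g ord0 k * congr_weight g' (k * (x : nat)%:Z + c) w t)%:E)%E.
  by rewrite lee_fin mulr_ge0// congr_weight_ge0// => j ?; exact: g0.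
have [j' j0E|j0E] := unliftP ord0 j0; last first.
  (* The distinguished coordinate comes first: sum over it with the other
     coordinates in the constant of the congruence. *)
  rewrite exchange_big /=.
  apply: (@le_trans _ _ (\sum_(w : n.-tuple 'I_N | [forall j, tnth w j \in U])
      \esum_(t in [set: n.-tuple int]) ((G ord0)%:E * (\prod_(j < n) g' j (tnth t j))%:E))%E).
    apply: lee_sum => w _.
    under eq_bigr do rewrite exchange_esum//.
    rewrite -esum_sum; last by move=> t x _ _; exact: esum_ge0.
    apply: le_esum => t _.
    apply: (@le_trans _ _ (\sum_(x in U) ((\prod_(j < n) g' j (tnth t j))%:E * 
       \esum_(k in [set: int]) (if (N%:Z %| (k * (x : nat)%:Z + (lattice_dot t w + c))%R)%Z
         then g ord0 k else 0)%:E))%E).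
      apply: lee_sum => x _; rewrite -esumZl ?prodr_ge0//; last 2 first.
      - by move=> j _; exact: g0.
      - by move=> k; case: ifP; rewrite lee_fin.
      apply: le_esum => k _; rewrite -EFinM lee_fin /congr_weight.
      rewrite (_ : lattice_dot t w + (_ + c) = k * (x : nat)%:Z + (lattice_dot t w + c)); last by ring.
      by case: ifP => _; rewrite ?mulr0// mulrC.
    rewrite -ge0_sume_distrr; last first.
      by move=> x _; apply: esum_ge0 => k _; case: ifP; rewrite lee_fin.
    rewrite muleC lee_wpmul2r// ?lee_fin ?prodr_ge0//; first by move=> j _; exact: g0.
    by have := gj0 (lattice_dot t w + c); rewrite j0E.
  apply: (@le_trans _ _ (\sum_(w : n.-tuple 'I_N | [forall j, tnth w j \in U])
      (\prod_(j < n.+1) G j)%:E)%E).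
    apply: lee_sum => w _; rewrite esumZl//; last first.
      by move=> t; rewrite lee_fin prodr_ge0// => j _; exact: g0.
    rewrite prodE EFinM lee_wpmul2l ?lee_fin//.
    by apply: esum_tuple_prod => [j k|j]; [exact: g0|exact: gG].
  by rewrite sumEFin lee_fin sumr_const (card_tuple_in n (mem U)) -[X in X <= _]mulr_natl.
(* The distinguished coordinate is among the others: the induction hypothesis
   bounds the inner sums uniformly in the first coordinate. *)
apply: (@le_trans _ _ (\sum_(x in U) \esum_(k in [set: int])
   (((#|U| ^ n.-1)%:R * \prod_(j < n) G' j)%:E * (g ord0 k)%:E))%E).
  apply: lee_sum => x _; rewrite -esum_sum; last first.
    by move=> k w _ _; exact: esum_ge0.
  apply: le_esum => k _.
  have -> : (\sum_(w : n.-tuple 'I_N | [forall j, tnth w j \in U])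
     \esum_(t in [set: n.-tuple int])
       (g ord0 k * congr_weight g' (k * (x : nat)%:Z + c) w t)%:E =
     (g ord0 k)%:E * \sum_(w : n.-tuple 'I_N | [forall j, tnth w j \in U])
     \esum_(t in [set: n.-tuple int])
       (congr_weight g' (k * (x : nat)%:Z + c) w t)%:E)%E.
    rewrite ge0_sume_distrr; last by move=> w _; apply: esum_ge0 => t _; exact: W0.
    by apply: eq_bigr => w _; rewrite -esumZl// => t; exact: W0.
  rewrite muleC lee_wpmul2r ?lee_fin//.
  apply: (IHn _ _ j') => [j l|j|e]; [exact: g0|exact: gG|].
  by rewrite /g' /G' -j0E.
rewrite esumZl//; [|by rewrite mulr_ge0// prodr_ge0// => j _; exact: G0|by move=> k; rewrite lee_fin].
have P0 : 0 <= (#|U| ^ n.-1)%:R * \prod_(j < n) G' j.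
  by rewrite mulr_ge0// prodr_ge0// => j _; exact: G0.
apply: (@le_trans _ _ (\sum_(x in U)
   ((#|U| ^ n.-1)%:R * (\prod_(j < n) G' j) * G ord0)%:E)%E).
  by apply: lee_sum => x _; rewrite [in leRHS]EFinM lee_wpmul2l// lee_fin.
rewrite sumEFin lee_fin sumr_const prodE -[leLHS]mulr_natl.
have -> : (#|U| ^ n = #|U| * #|U| ^ n.-1)%N.
  by rewrite -expnS prednK// (leq_ltn_trans _ (ltn_ord j')).
by rewrite natrM (mulrC (G ord0)) !mulrA.
Qed.
End dual_tuple_sums.

(** * The weights of the Korobov space *)

Section korobov_weight_sums.
Context (R : realType) (N s : nat) (alpha : R) (gamma : {set 'I_s} -> R).
Hypotheses (N0 : (0 < N)%N) (gamma_gt0 : forall u, 0 < gamma u).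
Implicit Types (k : s.-tuple int) (u : {set 'I_s}).

(** Its product over [j] is supported on the frequencies with support [u], which
    turns a sum over such frequencies into a sum over all tuples. *)
Definition coord_weight (a : R) u (j : 'I_s) (k : int) : R :=
  if j \in u then abs_powN a k else (k == 0)%:R.

Lemma coord_weight_ge0 a u j (k : int) : 0 <= coord_weight a u j k.
Proof. by rewrite /coord_weight; case: ifP => // _; exact: abs_powN_ge0. Qed.

Lemma prod_coord_weight a u k :
  \prod_(j < s) coord_weight a u j (tnth k j) =
  if zsupport k == u then \prod_(j in u) (`|tnth k j|%:~R `^ (- a)) else 0.
Proof.
case: eqP => [ku|ku].
  rewrite [RHS]big_mkcond; apply: eq_bigr => j _.
  have jE : (j \in u) = (tnth k j != 0) by rewrite -ku inE.
  rewrite /coord_weight /abs_powN jE.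
  by case: (tnth k j == 0).
apply/eqP/prodf_eq0.
have [j ju] : exists j, (j \in zsupport k) != (j \in u).
  apply/existsP; apply: contra_notT ku; rewrite negb_exists => /forallP h.
  by apply/setP => j; apply/eqP; have := h j; rewrite negbK.
exists j => //; move: ju; rewrite inE /coord_weight /abs_powN.
by case: (tnth k j == 0); case: (j \in u) => //= _; rewrite oner_eq0.
Qed.

Definition coord_total (a : R) u (j : 'I_s) : R := if j \in u then 2 * zeta a else 1.

Lemma prod_coord_total a u :
  \prod_(j < s) coord_total a u j = (2 * zeta a) ^+ #|u|.
Proof. by rewrite -big_mkcond/= prodr_const. Qed.

Lemma esum_coord_weight a u j : 1 < a ->
  (\esum_(k in [set: int]) (coord_weight a u j k)%:E <= (coord_total a u j)%:E)%E.
Proof.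
move=> a1; rewrite /coord_weight /coord_total; case: ifP => _.
  by rewrite esum_abs_powN.
rewrite (_ : (fun k : int => _) = (fun k : int => if k \in [set 0%R] then 1%:E else 0%:E)).
  by rewrite -esum_mkcond esum_set1.
apply/funext => k; case: eqVneq => [->|k0]; first by rewrite mem_set.
by rewrite memNset//; apply/eqP.
Qed.

Lemma powR_prod (I : finType) (P : pred I) (F : I -> R) (x : R) :
  (forall i, P i -> 0 <= F i) ->
  (\prod_(i | P i) F i) `^ x = \prod_(i | P i) (F i) `^ x.
Proof.
move=> F0.
suff [_ //] : 0 <= \prod_(i | P i) F i /\
    (\prod_(i | P i) F i) `^ x = \prod_(i | P i) (F i) `^ x.
apply: (big_rec2 (fun p q => 0 <= p /\ p `^ x = q)); first by rewrite powR1.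
move=> i p q Pi [p0 <-]; split; first by rewrite mulr_ge0// F0.
by rewrite powRM// F0.
Qed.

Lemma korobov_r_powR k (l : R) :
  (korobov_r alpha gamma k ^+ 2) `^ l =
  \sum_u gamma u `^ (2 * l) * \prod_(j < s) coord_weight (2 * alpha * l) u j (tnth k j).
Proof.
have r0 := korobov_r_gt0 alpha gamma_gt0 k.
rewrite (bigD1 (zsupport k))//= [X in _ + X]big1 ?addr0 => [|u uk]; last first.
  by rewrite prod_coord_weight eq_sym (negbTE uk) mulr0.
rewrite prod_coord_weight eqxx -powR_mulrn ?(ltW r0)// -powRrM /korobov_r.
rewrite powRM ?(ltW (gamma_gt0 _))//; last first.
  by apply: prodr_ge0 => j _; exact: powR_ge0.
congr (_ * _); rewrite powR_prod => [|j _]; last exact: powR_ge0.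
apply: eq_bigr => j _; rewrite -powRrM; congr (_ `^ _); ring.
Qed.

Lemma rsummable_korobov_r : 1 / 2 < alpha ->
  rsummable (fun k => korobov_r alpha gamma k ^+ 2).
Proof.
move=> a2; have a1 : 1 < 2 * alpha * 1 by lra.
apply: ge0_rsummable => [k|]; first exact: sqr_ge0.
rewrite (_ : (fun k => _) = (fun k => \sum_u (gamma u `^ (2 * 1) *
   \prod_(j < s) coord_weight (2 * alpha * 1) u j (tnth k j))%:E)%E); last first.
  apply/funext => k; rewrite sumEFin -korobov_r_powR powRr1//; exact: sqr_ge0.
have w0 u k : 0 <= \prod_(j < s) coord_weight (2 * alpha * 1) u j (tnth k j).
  by apply: prodr_ge0 => j _; exact: coord_weight_ge0.
rewrite esum_sum => [|k u _ _]; last by rewrite lee_fin mulr_ge0// powR_ge0.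
apply: lte_sum_pinfty => u _.
under eq_esum do rewrite EFinM.
rewrite esumZl ?powR_ge0//; last by move=> k; rewrite lee_fin.
rewrite lte_mul_pinfty// ?lee_fin ?powR_ge0//.
apply: le_lt_trans (esum_tuple_prod _ (fun j => esum_coord_weight u j a1)) _.
  by move=> j k; exact: coord_weight_ge0.
exact: ltry.
Qed.

Lemma dual_weight_powR k z (l : R) : 0 < l ->
  (dual_weight (N := N) alpha gamma k z) `^ l =
  \sum_(u : {set 'I_s} | u != finset.set0) gamma u `^ (2 * l) *
     congr_weight (coord_weight (2 * alpha * l) u) 0 z k.
Proof.
move=> l0; rewrite /dual_weight /congr_weight addr0 -/(dual k z).
have [dk|dk] := boolP (dual k z); last first.
  rewrite andbF powR0 ?gt_eqF// big1// => u _; by rewrite mulr0.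
rewrite andbT; case: eqVneq => [k0|k0] /=.
  rewrite powR0 ?gt_eqF// big1// => u u0.
  by rewrite prod_coord_weight k0 eq_sym (negbTE u0) mulr0.
rewrite korobov_r_powR (bigD1 finset.set0)//= prod_coord_weight (negbTE k0).
by rewrite mulr0 add0r.
Qed.

(** For each nonempty support [u], any of its elements can play the role of the
    distinguished coordinate. *)
Lemma sum_unit_dual_weight (l : R) : 0 < l -> 1 < 2 * alpha * l ->
  (\sum_(z in unit_vectors N s) \esum_(k in [set: s.-tuple int])
      (dual_weight alpha gamma k z `^ l)%:E <=
   ((#|unit_residues N| ^ s.-1)%:R * 
    \sum_(u : {set 'I_s} | u != finset.set0)
      gamma u `^ (2 * l) * (2 * zeta (2 * alpha * l)) ^+ #|u|)%:E)%E.
Proof.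
move=> l0 a1; set a := 2 * alpha * l in a1 *.
have W0 u z k : (0 <= (congr_weight (N := N) (coord_weight a u) 0 z k)%:E)%E.
  by rewrite lee_fin congr_weight_ge0// => j ?; exact: coord_weight_ge0.
apply: (@le_trans _ _ (\sum_(u : {set 'I_s} | u != finset.set0)
  \sum_(z in unit_vectors N s) ((gamma u `^ (2 * l))%:E *
     \esum_(k in [set: s.-tuple int]) (congr_weight (coord_weight a u) 0 z k)%:E))%E).
  rewrite exchange_big /=; apply: lee_sum => z _.
  under eq_esum => k _ do rewrite dual_weight_powR// -sumEFin.
  rewrite esum_sum => [|k u _ _]; last first.
    by rewrite EFinM mule_ge0// lee_fin powR_ge0.
  apply: lee_sum => u _; rewrite -esumZl ?powR_ge0//.
rewrite mulr_sumr -sumEFin; apply: lee_sum => u u0.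
rewrite -ge0_sume_distrr => [|z _]; last by apply: esum_ge0 => k _; exact: W0.
rewrite mulrCA EFinM lee_wpmul2l ?lee_fin ?powR_ge0//.
have [j0 j0u] : exists j, j \in u by apply/set0Pn.
rewrite -prod_coord_total.
rewrite (eq_bigl (fun z : s.-tuple 'I_N => [forall j, tnth z j \in unit_residues N])); last first.
  by move=> z; rewrite inE.
apply: (sum_esum_congr_weight (j0 := j0)) => [j k|j|c].
- exact: coord_weight_ge0.
- exact: esum_coord_weight.
- rewrite /coord_weight /coord_total j0u.
  exact: sum_unit_abs_powN.
Qed.

End korobov_weight_sums.

(** * Proportion of bad generating vectors *)

Section bad_vectors.
Context (R : realType).

(** If the sum of the [a k `^ l] is at most [t], then each [a k] is at most
    [t `^ l^-1], so [a k] is at most [t `^ (l^-1 - 1) * a k `^ l]; summing these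
    bounds gives the subadditivity of [x `^ l] without finite approximations. *)
Lemma rsum_le_powR (T : countType) (a : T -> R) (l t : R) :
  (forall k, 0 <= a k) -> rsummable a -> 0 < l -> l < 1 -> 0 < t ->
  (\esum_(k in [set: T]) (a k `^ l)%:E <= t%:E)%E -> rsum a <= t `^ l^-1.
Proof.
move=> a0 sa l0 l1 t0 at_; rewrite -lee_fin ge0_rsumE//.
have ak k : a k `^ l <= t.
  rewrite -lee_fin; apply: le_trans at_; rewrite (esumID [set k]); last first.
    by move=> j _; rewrite lee_fin powR_ge0.
  rewrite setTI esum_set1 ?lee_fin ?powR_ge0// leeDl// esum_ge0// => j _.
  by rewrite lee_fin powR_ge0.
have ak' k : a k <= t `^ (l^-1 - 1) * a k `^ l.
  have [->|ak0] := eqVneq (a k) 0; first by rewrite mulr_ge0// powR_ge0.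
  have {ak0} ak0 : 0 < a k by rewrite lt_neqAle eq_sym ak0 a0.
  have {1}-> : a k = (a k `^ l) `^ (l^-1 - 1) * a k `^ l.
    rewrite -powRrM -powRD; last by rewrite (gt_eqF ak0) implybT.
    by rewrite mulrBr mulr1 mulfV ?gt_eqF// subrK powRr1.
  rewrite ler_wpM2r ?powR_ge0// ge0_ler_powR// ?nnegrE ?powR_ge0 ?(ltW t0)//.
  by rewrite subr_ge0 invf_ge1// ltW.
apply: (@le_trans _ _ (\esum_(k in [set: T]) ((t `^ (l^-1 - 1))%:E * (a k `^ l)%:E))%E).
  by apply: le_esum => k _; rewrite -EFinM lee_fin.
rewrite esumZl ?powR_ge0// => [|k]; last by rewrite lee_fin powR_ge0.
apply: (@le_trans _ _ ((t `^ (l^-1 - 1))%:E * t%:E)%E).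
  by rewrite lee_wpmul2l// lee_fin powR_ge0.
rewrite -EFinM lee_fin -{2}(powRr1 (ltW t0)) -powRD ?subrK//.
by rewrite (gt_eqF t0) implybT.
Qed.

Lemma card_unit_residues N : (2 <= N)%N -> #|unit_residues N| = totient N.
Proof.
move=> N2; rewrite totient_count_coprime big_mkord -sum1_card.
rewrite big_mkcond; apply: eq_bigr => z _.
rewrite inE coprime_sym; case: (posnP z) => [->|z0]; last by case: coprime.
by rewrite /= /coprime gcdn0; case: N N2 z => [//|[//|n]].
Qed.

Lemma card_unit_vectors N s : #|unit_vectors N s| = (#|unit_residues N| ^ s)%N.
Proof. by rewrite -card_tuple_in; apply: eq_card => z; rewrite !inE. Qed.

Variables (N s : nat) (alpha : R) (gamma : {set 'I_s} -> R) (eta : R).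
Hypotheses (s0 : (0 < s)%N) (N2 : (2 <= N)%N) (gamma_gt0 : forall u, 0 < gamma u).
Hypotheses (alpha2 : 1 / 2 < alpha) (eta0 : 0 < eta).
Local Notation S z := (rsum (dual_weight (N := N) alpha gamma ^~ z)).

Let N0 : (0 < N)%N. Proof. exact: ltnW. Qed.

Definition weight_total (l : R) : R :=
  \sum_(u : {set 'I_s} | u != finset.set0)
     gamma u `^ (2 * l) * (2 * zeta (2 * alpha * l)) ^+ #|u|.

Lemma admissible_exponent (l : R) : (2 * alpha)^-1 < l < 1 ->
  [/\ 0 < l, l < 1 & 1 < 2 * alpha * l].
Proof.
have a0 : 0 < 2 * alpha by move: alpha2; lra.
case/andP => h1 h2; have l0 : 0 < l by apply: lt_trans h1; rewrite invr_gt0.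
by split => //; move: h1; rewrite -[_^-1]mul1r ltr_pdivrMr// mulrC.
Qed.

Lemma weight_total_gt0 (l : R) : 1 < 2 * alpha * l -> 0 < weight_total l.
Proof.
move=> a1.
have t0 u : 0 < gamma u `^ (2 * l) * (2 * zeta (2 * alpha * l)) ^+ #|u|.
  by rewrite mulr_gt0 ?powR_gt0// exprn_gt0// mulr_gt0// zeta_gt0.
rewrite /weight_total (bigD1 finset.setT)/=; last first.
  by apply/set0Pn; exists (Ordinal s0); rewrite inE.
by rewrite ltr_pwDl// sumr_ge0// => u _; exact: ltW.
Qed.

Lemma error_term_gt0 (l : R) : (2 * alpha)^-1 < l < 1 ->
  0 < error_term N alpha gamma eta l.
Proof.
move=> /admissible_exponent [l0 l1 a1].
rewrite powR_gt0// mulr_gt0 ?weight_total_gt0// invr_gt0 mulr_gt0// ltr0n.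
by rewrite totient_gt0.
Qed.

(** Markov's inequality for the counting measure on the admissible vectors. *)
Lemma card_bad_unit_vectors (l : R) : (2 * alpha)^-1 < l < 1 ->
  #|[pred z in unit_vectors N s | error_term N alpha gamma eta l ^+ 2 < S z]|%:R <=
  eta * #|unit_vectors N s|%:R.
Proof.
move=> /[dup] lr /admissible_exponent [l0 l1 a1].
set A := [pred z in _ | _].
have phi0 : 0 < (totient N)%:R :> R by rewrite ltr0n totient_gt0.
pose t := (eta * (totient N)%:R)^-1 * weight_total l.
have t0 : 0 < t by rewrite mulr_gt0 ?weight_total_gt0// invr_gt0 mulr_gt0.
have tE : error_term N alpha gamma eta l ^+ 2 = t `^ l^-1.
  rewrite -powR_mulrn ?powR_ge0// -powRrM; congr (_ `^ _).
  by field; rewrite gt_eqF.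
have sr := rsummable_korobov_r gamma_gt0 alpha2.
have At z : A z -> (t%:E <= \esum_(k in [set: s.-tuple int])
    (dual_weight alpha gamma k z `^ l)%:E)%E.
  case/andP => _; rewrite tE; apply: contraTT; rewrite -ltNge -leNgt => h.
  apply: (rsum_le_powR _ _ l0 l1 t0 (ltW h)) => [k|].
    exact: dual_weight_ge0.
  exact: rsummable_dual_weight.
have : (\sum_(z in unit_vectors N s) (if A z then t%:E else 0) <=
   ((#|unit_residues N| ^ s.-1)%:R * weight_total l)%:E)%E.
  apply: le_trans (sum_unit_dual_weight N0 gamma_gt0 l0 a1).
  apply: lee_sum => z _; case: ifP => [/At//|_].
  by apply: esum_ge0 => k _; rewrite lee_fin powR_ge0.
rewrite -big_mkcondr/= sumEFin lee_fin sumr_const.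
rewrite (eq_card (B := A)) => [|z]; last first.
  by rewrite -[LHS]/((z \in unit_vectors N s) && A z) /A /= andbA andbb.
rewrite -[leLHS]mulr_natr -ler_pdivlMl// => /le_trans; apply.
rewrite card_unit_vectors card_unit_residues// -{2}(prednK s0) expnS natrM.
rewrite /t; set W := weight_total l.
have W0 : W != 0 by rewrite gt_eqF// weight_total_gt0.
rewrite le_eqVlt; apply/orP; left; apply/eqP; field.
by rewrite W0 !gt_eqF.
Qed.

(** Failing the bound for some exponent, rather than for a given one, is what the
    infimum over the exponents requires. *)
Definition bad_vector (z : s.-tuple 'I_N) : bool :=
  `[< exists2 l, (2 * alpha)^-1 < l < 1 & error_term N alpha gamma eta l ^+ 2 < S z >].

(** Among the bad vectors take one with minimal [S]; an exponent for which it
    fails is one for which every bad vector fails. *)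
Lemma card_bad_vector :
  #|[pred z in unit_vectors N s | bad_vector z]|%:R <= eta * #|unit_vectors N s|%:R.
Proof.
have [[z0 bz0]|nob] := pselect (exists z, bad_vector z); last first.
  rewrite [X in X%:R <= _]eq_card0 => [|z]; first by rewrite mulr0n mulr_ge0// ltW.
  by apply/negbTE/negP => /andP[_ bz]; apply: nob; exists z.
case: (arg_minP (fun z => S z) bz0) => z1 /asboolP [l lr lz1] z1min.
apply: le_trans (card_bad_unit_vectors lr); rewrite ler_nat.
apply: subset_leq_card; apply/fintype.subsetP => z /andP[zU bz].
by rewrite inE zU /= (lt_le_trans lz1)// z1min.
Qed.

End bad_vectors.

(** * Probability of a good majority *)

Section majority_probability.
Context (R : realType) (d : measure_display) (Omega : measurableType d).
Variable P : probability Omega R.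

Lemma fsum_pred (F : finType) (B : pred F) (f : F -> \bar R) :
  (\sum_(v \in [set v | B v]) f v = \sum_(v | B v) f v)%E.
Proof.
rewrite (bigfs _ (r := index_enum F)) ?index_enum_uniq//.
by move=> v _; rewrite mem_index_enum.
Qed.

Lemma uniform_on_pred (F : finType) (A : {set F}) (X : Omega -> F) (B : pred F) :
  uniform_on P A X ->
  measurable (X @^-1` [set v | B v]) /\
  P (X @^-1` [set v | B v]) = (#|[pred v in A | B v]|%:R / #|A|%:R)%:E.
Proof.
move=> uX.
have E : X @^-1` [set v | B v] = \bigcup_(v in [set v | B v]) X @^-1` [set v].
  by apply/seteqP; split => [w Bw|w [v Bv /= ->]]; [exists (X w)|].
have fB : finite_set [set v | B v] by exact: finite_finset.
split.
  by rewrite E; apply: fin_bigcup_measurable => // v _; have [] := uX v.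
rewrite E measure_fin_bigcup//; last 2 first.
- by move=> v v' _ _ [w [/= <- <-]].
- by move=> v _; have [] := uX v.
rewrite fsum_pred (eq_bigr (fun v => ((v \in A)%:R / #|A|%:R)%:E)); last first.
  by move=> v _; have [] := uX v.
rewrite sumEFin -mulr_suml; congr (_ / _)%:E.
rewrite -natr_sum; congr _%:R.
rewrite -sum1_card big_mkcond [RHS]big_mkcond /=.
apply: eq_bigr => v _.
have -> : (v \in [pred v in A | B v]) = (v \in A) && B v by [].
by case: (B v); case: (v \in A).
Qed.

(** Finitely many random variables with finitely many values: any event they
    determine is a finite union of finite intersections. *)
Lemma measurable_preimage_fin (I F : finType) (z : I -> Omega -> F) (Q : (I -> F) -> Prop) :
  (forall i v, measurable (z i @^-1` [set v])) ->
  measurable [set w | Q (fun i => z i w)].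
Proof.
move=> mz.
rewrite (_ : [set w | _] = \bigcup_(v in [set v : {ffun I -> F} | Q v])
   \bigcap_(i in [set: I]) z i @^-1` [set v i]).
  apply: fin_bigcup_measurable => [|v _]; first exact: finite_finset.
  by apply: fin_bigcap_measurable.
apply/seteqP; split => w /=.
  move=> Qw; exists [ffun i => z i w] => [/=|i _ /=]; last by rewrite ffunE.
  by rewrite (_ : (fun_of_fin _ : I -> F) = (fun i => z i w))//; apply/funext => i; rewrite ffunE.
move=> [v /= Qv vw]; rewrite (_ : (fun i => z i w) = v)//.
by apply/funext => i; exact: (vw i Logic.I).
Qed.

(** If at most half of the indices avoid [B], some [r.+1./2] of them all fall in
    [B]; a union bound over these index sets and independence conclude. *)
Lemma probability_majority (r : nat) (F : finType) (A : {set F}) (B : pred F)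
    (z : 'I_r -> Omega -> F) (eta : R) (G : set Omega) :
  odd r -> 0 < eta ->
  (forall i, uniform_on P A (z i)) -> mutually_independent P z ->
  #|[pred v in A | B v]|%:R <= eta * #|A|%:R ->
  (0 < #|A|)%N ->
  measurable G ->
  (forall w, (r./2 < #|[pred i | ~~ B (z i w)]|)%N -> G w) ->
  ((1 - 'C(r, r.+1./2)%:R * eta ^+ r.+1./2)%:E <= P G)%E.
Proof.
move=> oddr eta0 uz iz Beta A0 mG majG; set m := r.+1./2.
have mzB i : measurable (z i @^-1` [set v | B v]).
  by have [] := uniform_on_pred B (uz i).
have PB i : (P (z i @^-1` [set v | B v]) <= eta%:E)%E.
  have [_ ->] := uniform_on_pred B (uz i).
  by rewrite lee_fin ler_pdivrMr// ltr0n.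
pose EJ (J : {set 'I_r}) := [set w | forall i, i \in J -> B (z i w)].
have mEJ J : measurable (EJ J).
  rewrite (_ : EJ J = \bigcap_(i in [set i | i \in J]) z i @^-1` [set v | B v]).
    by apply: fin_bigcap_measurable => //; exact: finite_finset.
  by apply/seteqP; split.
have PEJ (J : {set 'I_r}) : #|J| = m -> (P (EJ J) <= (eta ^+ m)%:E)%E.
  move=> Jm; rewrite (iz J (fun=> [set v | B v])) -Jm -prodr_const.
  have fP i : P (z i @^-1` [set v | B v]) = (fine (P (z i @^-1` [set v | B v])))%:E.
    by rewrite fineK// fin_num_measure.
  rewrite (eq_bigr _ (fun i _ => fP i)).
  rewrite prodEFin lee_fin; apply: ler_prod => i _; rewrite fine_ge0//=.
  by rewrite -lee_fin -fP.
(* Outside [G], the indices falling in [B] contain a set of [m] elements. *)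
have sub : ~` G `<=` \bigcup_(J in [set J : {set 'I_r} | #|J| == m]) EJ J.
  move=> w nG.
  pose K : {set 'I_r} := finset (fun i => B (z i w)).
  have Km : (m <= #|K|)%N.
    rewrite leqNgt; apply/negP => Km; apply: nG; apply: majG.
    have C : (#|K| + #|[pred i | ~~ B (z i w)]| = r)%N.
      rewrite -[RHS](card_ord r) -(cardC (mem K)); congr addn.
      by apply: eq_card => i; rewrite !inE.
    have := odd_double_half r; rewrite oddr -addnn add1n.
    move: Km C; rewrite /m -uphalfE uphalf_half oddr add1n ltnS.
    move: #|K| #|_| (r./2) => a b c; lia.
  have [J] : exists J : {set 'I_r}, J \in finset (fun J : {set 'I_r} => (J \subset K) && (#|J| == m)).
    by apply/card_gt0P; rewrite cards_draws bin_gt0.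
  rewrite inE => /andP[/fintype.subsetP JK Jm]; exists J => // i iJ.
  by have := JK i iJ; rewrite inE.
have PnG : (P (~` G) <= ('C(r, m)%:R * eta ^+ m)%:E)%E.
  apply: (@le_trans _ _ (\sum_(J : {set 'I_r} | #|J| == m) P (EJ J))%E).
    rewrite -fsum_pred; apply: content_sub_fsum => //.
    - exact: finite_finset.
    - exact: measurableC.
  apply: (@le_trans _ _ (\sum_(J : {set 'I_r} | #|J| == m) (eta ^+ m)%:E)%E).
    by apply: lee_sum => J /eqP; exact: PEJ.
  rewrite sumEFin lee_fin sumr_const -[leLHS]mulr_natl.
  by rewrite -[in leRHS](card_ord r) -card_draws cardsE.
have fG : P G = (fine (P G))%:E by rewrite fineK// fin_num_measure.
by move: PnG; rewrite probability_setC// fG -EFinB !lee_fin; lra.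
Qed.

End majority_probability.

(** * Worst-case error of the median rule *)

Theorem theorem2p5 (R : realType) (s N r : nat)
  (hs : (1 <= s)%N) (hN : (2 <= N)%N) (hr : odd r)
  (d : measure_display) (Omega : measurableType d) (P : probability Omega R)
  (z : 'I_r -> Omega -> s.-tuple 'I_N)
  (hunif : forall i, uniform_on P (unit_vectors N s) (z i))
  (hindep : mutually_independent P z)
  (alpha : R) (halpha : 1 / 2 < alpha)
  (gamma : {set 'I_s} -> R) (hgamma : forall u, 0 < gamma u)
  (hgamma0 : gamma finset.set0 = 1)
  (eta : R) (heta0 : 0 < eta) (heta1 : eta < 1) :
  ((1 - 'C(r, r.+1./2)%:R * eta ^+ r.+1./2)%:E <=
   P [set w | worst_case_error alpha gamma (median_rule (fun i => z i w)) <=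
              error_bound N alpha gamma eta])%E.
Proof.
have N0 : (0 < N)%N by exact: ltnW.
have sr := rsummable_korobov_r hgamma halpha.
apply: (probability_majority (A := unit_vectors N s) (B := bad_vector alpha gamma eta)
  hr heta0 hunif hindep).
- exact: card_bad_vector.
- by rewrite card_unit_vectors expn_gt0 card_unit_residues// totient_gt0 N0.
- apply: (@measurable_preimage_fin _ _ _ _ z (fun v =>
    (worst_case_error alpha gamma (median_rule v) <= error_bound N alpha gamma eta)%E)).
  by move=> i v; have [] := hunif i v.
move=> w maj; apply/ereal_infP => _ [l lr <-].
have e0 := error_term_gt0 hs hN hgamma halpha heta0 lr.
apply: worst_case_error_median => //.
apply: leq_trans maj _; apply: subset_leq_card; apply/fintype.subsetP => i.
rewrite !inE; apply: contraR; rewrite -ltNge => h.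
by apply/asboolP; exists l.
Qed.
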